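(* Let $n\ge2$, let $P$ be a positive regular polynomial $n$-tuple and let $m\in\mathbb N^n$. The Taylor spectrum of the multiplication $n$-tuple $\mathscr M_z$ on $\mathscr H^2_m(\triangle^n_P)$ is a connected subset of $\mathbb C^n$ that contains $\overline{\triangle^n_P}$.
   Context: $\mathbb N$ = positive integers, $\mathbb C_*=\mathbb C\setminus\{0\}$, $z\diamond w=(z_1w_1,\ldots,z_nw_n)$, and $\overline z$ is the entrywise conjugate for points; $\overline{\triangle^n_P}$ is the topological closure. For $n\ge2$ let $\varphi(z)=\big(\frac{z_1}{z_2},\ldots,\frac{z_{n-1}}{z_n},z_n\big)$ for $z\in\mathbb C\times\mathbb C_*^{n-1}$. A polynomial $n$-tuple $P=(P_1,\ldots,P_n)$ in $\mathbb C[z_1,\ldots,z_n]$ is positive regular if for each $j$, $P_j$ has nonnegative coefficients and $P_j(z)=a_jz_j+\sum_{k=2}^{N_j}Q_{jk}(z)$ with $a_j>0$ and $Q_{jk}$ homogeneous of degree $k$. The $P$-triangle is $\triangle^n_P=\{z\in\mathbb C\times\mathbb C_*^{n-1}: P_j(\varphi(z)\diamond\overline{\varphi(z)})<1,\ j=1,\ldots,n\}$. For $m\in\mathbb N^n$, $\mathscr H^2_m(\triangle^n_P)$ is the reproducing kernel Hilbert space of holomorphic functions on $\triangle^n_P$ with kernel $$\mathscr K_{P,m}(z,w)=\prod_{j=2}^n\frac1{z_j\overline w_j}\prod_{j=1}^n\frac1{\big(1-P_j(\varphi(z)\diamond\overline{\varphi(w)})\big)^{m_j}}.$$ Each $z_j$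 is a multiplier of this space; $\mathscr M_{z_j}$ is the bounded operator of multiplication by $z_j$, and $\mathscr M_z=(\mathscr M_{z_1},\ldots,\mathscr M_{z_n})$. *)

(* Defs.v *)
From HB Require Import structures.
From mathcomp Require Import all_boot all_order all_algebra.
(* The notations of mpoly clash with those of all_analysis, hence -(notations). *)
From mathcomp Require Import -(notations) mpoly.
From mathcomp Require Import all_classical all_reals all_analysis.
From mathcomp Require Import complex.

Set Implicit Arguments.
Unset Strict Implicit.
Unset Printing Implicit Defensive.

Import Order.TTheory GRing.Theory Num.Theory.
Import numFieldNormedType.Exports.

Local Open Scope classical_set_scope.
Local Open Scope ring_scope.

(* The usual topology of the complex numbers.  With it ['rV[R[i]]_n] is C^n,
   and [differentiable] is complex (Frechet) differentiability, since the field
   of scalars is [R[i]]. *)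
HB.instance Definition _ (R : realType) := NormedModule.copy R[i] R[i]^o.

(* The order on [R[i]] is the partial one: [0 <= z] (resp. [z < 1]) says that z
   is real and nonnegative (resp. real and less than 1). *)

Section Triangle.
Variables (R : realType) (n : nat).
Local Notation C := R[i].

Definition diamond (z w : 'rV[C]_n) : 'rV[C]_n := \row_j (z 0 j * w 0 j).

Definition conjv (z : 'rV[C]_n) : 'rV[C]_n := \row_j (z 0 j)^*.

(* [ordS j] has value j + 1 as soon as j.+1 < n. *)
Definition phi (z : 'rV[C]_n) : 'rV[C]_n :=
  \row_j (if (j.+1 < n)%N then z 0 j / z 0 (ordS j) else z 0 j).

Definition poly_at (p : mpoly n C) (z : 'rV[C]_n) : C :=
  meval (fun j => z 0 j) p.

Definition positive_regular (P : 'I_n -> mpoly n C) : Prop :=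
  forall j,
    (forall k : multinom n, 0 <= mcoeff k (P j)) /\
    exists (a : C) (N : nat) (Q : nat -> mpoly n C),
      [/\ 0 < a,
          forall k, Q k \is ishomog1 k mdeg &
          P j = a *: mpolyX C (mnm1 j)
                + \sum_(2 <= k < N.+1) Q k].

(* Coordinates are numbered from 0: the condition [0 < j] is the original
   condition j >= 2. *)
Definition triangle (P : 'I_n -> mpoly n C) : set 'rV[C]_n :=
  [set z : 'rV[C]_n | (forall j : 'I_n, (0 < j)%N -> z 0 j != 0) /\
           forall j, poly_at (P j) (diamond (phi z) (conjv (phi z))) < 1].

Definition triangle_kernel (P : 'I_n -> mpoly n C) (m : 'I_n -> nat)
    (z w : 'rV[C]_n) : C :=
  (\prod_(j < n | (0 < j)%N) (z 0 j * (w 0 j)^*)^-1) *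
  \prod_(j < n)
    ((1 - poly_at (P j) (diamond (phi z) (conjv (phi w)))) ^+ m j)^-1.

End Triangle.

Definition holomorphic_on (R : realType) (n : nat) (D : set 'rV[R[i]]_n)
    (f : 'rV[R[i]]_n -> R[i]) : Prop :=
  forall z, D z -> differentiable f z.

(* A Hilbert space of holomorphic functions on the open set D with reproducing
   kernel K.  A vector f stands for the function [rkhs_eval f] restricted to D:
   the values of [rkhs_eval f] outside D carry no information, and by
   [rkhs_ext] the vector f is determined by the values on D.  The inner product
   is linear in its first argument. *)
Record rkhs (R : realType) (n : nat) (D : set 'rV[R[i]]_n)
    (K : 'rV[R[i]]_n -> 'rV[R[i]]_n -> R[i]) := Rkhs {
  rkhs_space :> completeNormedModType R[i];
  rkhs_dot : {dot rkhs_space for Num.conj};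
  rkhs_normE : forall f, `|f| ^+ 2 = rkhs_dot f f;
  rkhs_eval : {linear rkhs_space -> ('rV[R[i]]_n -> R[i])};
  rkhs_ext : forall f g,
    (forall z, D z -> rkhs_eval f z = rkhs_eval g z) -> f = g;
  rkhs_holomorphic : forall f, holomorphic_on D (rkhs_eval f);
  rkhs_reproducing : forall w, D w -> exists2 k : rkhs_space,
    (forall z, D z -> rkhs_eval k z = K z w) &
    (forall f, rkhs_dot f k = rkhs_eval f w)
}.

(* Multiplication by the function g: [mulop g f] is the unique element of H
   equal to g f on D.  The value 0 is a dummy for the case where g f is not in
   H; it never occurs if g is a multiplier of H. *)
Definition mulop (R : realType) (n : nat) (D : set 'rV[R[i]]_n)
    (K : 'rV[R[i]]_n -> 'rV[R[i]]_n -> R[i]) (H : rkhs D K)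
    (g : 'rV[R[i]]_n -> R[i]) (f : H) : H :=
  xget 0 [set h : H | forall z, D z -> rkhs_eval H h z = g z * rkhs_eval H f z].

Definition coord_mulop (R : realType) (n : nat) (D : set 'rV[R[i]]_n)
    (K : 'rV[R[i]]_n -> 'rV[R[i]]_n -> R[i]) (H : rkhs D K) (j : 'I_n) :
    H -> H :=
  mulop (fun z : 'rV[R[i]]_n => z 0 j).
Arguments coord_mulop {R n D K} H j f.

Section TaylorSpectrum.
Variables (F : fieldType) (n : nat) (V : lmodType F).

(* The Koszul complex of T on V (x) /\ F^n.  A chain x is the sum over S of
   x S (x) e_S, where e_S is the wedge, in increasing order, of the e_j with
   j in S; the differential sends v (x) e_S to the sum over j of
   T j v (x) (e_j /\ e_S). *)
Definition koszul_deg (p : nat) (x : {ffun {set 'I_n} -> V}) : Prop :=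
  forall S : {set 'I_n}, #|S| != p -> x S = 0.

Definition koszul_d (T : 'I_n -> V -> V) (x : {ffun {set 'I_n} -> V}) :
    {ffun {set 'I_n} -> V} :=
  [ffun S : {set 'I_n} =>
     \sum_(j in S) (-1) ^+ #|[set i in S | (i < j)%N]%SET| *: T j (x (S :\ j)%SET)].

(* The chains y in degree p - 1 are those with [y S = 0] unless |S| + 1 = p;
   only y = 0 if p = 0. *)
Definition koszul_exact (T : 'I_n -> V -> V) : Prop :=
  forall (p : nat) (x : {ffun {set 'I_n} -> V}),
    koszul_deg p x -> koszul_d T x = 0 ->
    exists y : {ffun {set 'I_n} -> V},
      (forall S : {set 'I_n}, #|S|.+1 != p -> y S = 0) /\ koszul_d T y = x.

(* The Taylor spectrum of an n-tuple T of commuting linear operators. *)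
Definition taylor_spectrum (T : 'I_n -> V -> V) : set 'rV[F]_n :=
  [set lambda | ~ koszul_exact (fun j v => T j v - lambda 0 j *: v)].

End TaylorSpectrum.

(* Main.v *)
Require Import Defs.
From HB Require Import structures.
From mathcomp Require Import all_boot all_order all_algebra.
From mathcomp Require Import -(notations) mpoly.
From mathcomp Require Import all_classical all_reals all_analysis.
From mathcomp Require Import complex.
From mathcomp Require Import ring lra.

Set Implicit Arguments.
Unset Strict Implicit.
Unset Printing Implicit Defensive.

Import Order.TTheory GRing.Theory Num.Theory.
Import numFieldNormedType.Exports.

Local Open Scope classical_set_scope.
Local Open Scope ring_scope.

(* Idea.  In the coordinates u = phi z the kernel is, up to a rank-one factor,
   the product of the (1 - P_j(u u'^* ))^-m_j, so K (1 - P_j) is positive for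
   every j.  Hence each u_j is a multiplier (P_j dominates a_j u_j u'_j^* ), and so
   is each z_j = u_j u_(j+1) ... u_n.

   Let l be a point with u0 = phi l.  If l_(j+1) = 0 but l_j <> 0, the identity
   z_j = u_j z_(j+1) puts 1 in the ideal of multipliers generated by the
   z_i - l_i.  Otherwise u_j u0_j^* is congruent to |u0_j|^2 modulo this ideal,
   also when u0_j = 0, so the ideal contains c - q with q = P_j(u u0^* ) and
   c = P_j(|u0|^2).  By Cauchy-Schwarz the multiplier norm of q is at most
   sqrt c, so c - q is invertible as soon as c > 1.  When 1 is in the ideal the
   Koszul complex has a contracting homotopy; hence the spectrum lies in the set
   of the l with l_(j+1) = 0 -> l_j = 0 and P_j(|phi l|^2) <= 1.

   Conversely this set is contained in the closure of the triangle, and the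
   closure is contained in the spectrum: if the Koszul complex at l were exact,
   the normalized kernel functions at points w tending to l would decay
   pointwise like |w - l|, which a gliding hump forbids.  Finally, the set is
   star-shaped for the weighted dilations l_j -> t^(n-j) l_j (j counted from
   0), hence connected. *)

Local Notation Re := complex.Re.

(** * The Koszul complex *)

(** The exponent of the sign in [koszul_d]: the number of factors of e_S that e_j has to pass to
    reach its place. *)
Definition koszul_sign n (S : {set 'I_n}) (j : 'I_n) :=
  #|[set i in S | (i < j)%N]%SET|.

Lemma koszul_signD1 n (S : {set 'I_n}) (j k : 'I_n) : j \in S ->
  koszul_sign S k = ((j < k)%N + koszul_sign (S :\ j)%SET k)%N.
Proof.
move=> jS; rewrite /koszul_sign (cardsD1 j) inE jS /=; congr addn.
by apply: eq_card => i; rewrite !inE andbA.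
Qed.

Lemma koszul_signD1_id n (S : {set 'I_n}) (j : 'I_n) :
  koszul_sign (S :\ j)%SET j = koszul_sign S j.
Proof.
apply: eq_card => i; rewrite !inE; case: eqVneq => //= ->.
by rewrite ltnn andbF.
Qed.

(* The [B j] define a contracting homotopy [y] of the Koszul complex. *)
Lemma koszul_exact_unit (F : fieldType) (n : nat) (V : lmodType F)
    (T B : 'I_n -> {linear V -> V}) :
  (forall j k v, T j (B k v) = B k (T j v)) ->
  (forall v, \sum_j B j (T j v) = v) ->
  koszul_exact (fun j => T j).
Proof.
move=> TB BT p x degx dx0.
pose y := [ffun S : {set 'I_n} =>
  \sum_(k | k \notin S) (-1) ^+ koszul_sign S k *: B k (x (k |: S)%SET)] :
  {ffun {set 'I_n} -> V}.
exists y; split=> [S Sp|].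
  rewrite ffunE big1 // => k kS.
  by rewrite degx ?linear0 ?scaler0 // cardsU1 kS.
apply/ffunP => S; rewrite ffunE.
(* The inner term k = j gives [B j (T j (x S))], as its two signs cancel. The terms with k outside S
   are rewritten to prepare the use of [koszul_d T x] at [k |: S]. *)
have yE j : j \in S -> (-1) ^+ koszul_sign S j *: T j (y (S :\ j)%SET) =
    B j (T j (x S)) + \sum_(k | k \notin S) (-1) ^+ koszul_sign S k *:
      B k (- ((-1) ^+ koszul_sign (k |: S)%SET j *: T j (x ((k |: S) :\ j)%SET))).
  move=> jS; rewrite ffunE (bigD1 j) /= ?inE ?eqxx //= linearD scalerDr.
  congr (_ + _).
    rewrite linearZ /= scalerA koszul_signD1_id -exprD addnn -mul2n exprM.
    by rewrite sqrrN !expr1n scale1r TB finset.setD1K.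
  rewrite linear_sum scaler_sumr /=; apply: eq_big => [k|k].
    by rewrite !inE negb_and negbK; case: (eqVneq k j) => [->|] /=;
      rewrite ?jS ?andbF ?andbT.
  rewrite !inE negb_and negbK => /andP[/orP[/eqP->|kS] kj]; first by rewrite eqxx in kj.
  rewrite linearN !linearZ /= scalerN -scalerN 2!scalerA scalerN -scaleNr TB.
  have -> : (k |: S :\ j = (k |: S) :\ j)%SET.
    by apply/setP => i; rewrite !inE; case: (eqVneq i k) => [->|]; rewrite ?kj.
  congr (_ *: _).
  rewrite (koszul_signD1 k jS) (@koszul_signD1 _ (k |: S)%SET k j) ?finset.setU11 //.
  rewrite finset.setU1K //.
  rewrite !exprD mulrACA [X in - (_ * X)]mulrC.
  (* Exactly one of k < j and j < k holds: this is the anticommutation of e_j and e_k. *)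
  suff -> : (-1) ^+ (k < j)%N * (-1) ^+ (j < k)%N = -1 :> F by rewrite mulN1r opprK.
  have [jk|kj'|/val_inj jk] := ltngtP j k; last by rewrite jk eqxx in kj.
    by rewrite mul1r.
  by rewrite mulr1.
rewrite (eq_bigr _ yE) big_split /= exchange_big /=.
(* [BT] splits [x S] into the terms with index in S, already present, and those with index k outside
   S, which come from [dx0] read at [k |: S]. *)
rewrite -[RHS](BT (x S)) [RHS](bigID (mem S)) /=; congr (_ + _).
apply: eq_bigr => k kS; rewrite -scaler_sumr -linear_sum /= sumrN.
have := congr1 (fun f : {ffun {set 'I_n} -> V} => f (k |: S)%SET) dx0.
rewrite !ffunE (bigD1 k) ?finset.setU11 //= finset.setU1K //.
have -> : \sum_(i in (k |: S)%SET | i != k)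
    (-1) ^+ koszul_sign (k |: S)%SET i *: T i (x ((k |: S) :\ i)%SET) =
  \sum_(i in S) (-1) ^+ koszul_sign (k |: S)%SET i *: T i (x ((k |: S) :\ i)%SET).
  apply: eq_bigl => i; rewrite !inE; case: (eqVneq i k) => [->|] /=.
    by rewrite (negbTE kS).
  by rewrite andbT.
move=> /eqP; rewrite addr_eq0 => /eqP <-.
rewrite -/(koszul_sign _ _) -(koszul_signD1_id (k |: S)%SET) finset.setU1K //.
by rewrite linearZ scalerA -exprD addnn -mul2n exprM sqrrN !expr1n scale1r.
Qed.

(** * Complex Hilbert spaces *)

Lemma Re_ge0 (R : realType) (z : R[i]) : 0 <= z -> 0 <= Re z.
Proof. by case: z => a b; rewrite lecE => /andP[]. Qed.

Lemma ler_Re (R : realType) (x y : R[i]) : x <= y -> Re x <= Re y.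
Proof. by rewrite lecE => /andP[]. Qed.

Lemma ReD (R : realType) (x y : R[i]) : Re (x + y) = Re x + Re y.
Proof. by case: x y => a b []. Qed.

Lemma normr_ReE (R : realType) (z : R[i]) : (Re `|z|)%:C%C = `|z|.
Proof. by rewrite RRe_real ?normr_real. Qed.

Lemma realcM (R : realType) (a b : R) : ((a * b)%:C = a%:C * b%:C :> R[i])%C.
Proof. exact: rmorphM. Qed.

Lemma realcB (R : realType) (a b : R) : ((a - b)%:C = a%:C - b%:C :> R[i])%C.
Proof. exact: rmorphB. Qed.

Lemma realc_conj (R : realType) (a : R) : (a%:C%C)^* = a%:C%C :> R[i].
Proof. exact: conjc_real. Qed.

Lemma normr_realc (R : realType) (a : R) : `|a%:C%C| = `|a|%:C%C :> R[i].
Proof. by rewrite normc_def /= expr0n addr0 sqrtr_sqr. Qed.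

Lemma realcX (R : realType) (a : R) k : ((a ^+ k)%:C = a%:C ^+ k :> R[i])%C.
Proof. exact: rmorphXn. Qed.

Lemma realc_sum (R : realType) (I : Type) (r : seq I) (F : I -> R) :
  ((\sum_(i <- r) F i)%:C = \sum_(i <- r) (F i)%:C :> R[i])%C.
Proof. exact: rmorph_sum. Qed.

Lemma ler_complexR (R : realType) (z : R[i]) (a : R) : 0 <= z ->
  (z <= a%:C%C) = (Re z <= a).
Proof. by case: z => b c; rewrite !lecE /= => /andP[/eqP -> _]; rewrite eqxx. Qed.

Lemma ltr_complexR (R : realType) (z : R[i]) (a : R) : 0 <= z ->
  (z < a%:C%C) = (Re z < a).
Proof. by case: z => b c; rewrite lecE ltcE /= => /andP[/eqP -> _]; rewrite eqxx. Qed.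

(** Norms over [R[i]] take values in [R[i]]; the real part brings the estimates into the ordered
    field [R]. *)
Definition rnorm (R : realType) (V : normedModType R[i]) (x : V) : R := Re `|x|.

Section RealNorm.
Variables (R : realType) (V : normedModType R[i]).
Implicit Types x y : V.

Lemma rnormE x : `|x| = (rnorm x)%:C%C.
Proof. by rewrite RRe_real // normr_real. Qed.

Lemma rnorm_ge0 x : 0 <= rnorm x.
Proof. exact: Re_ge0 (normr_ge0 x). Qed.

Lemma rnormD x y : rnorm (x + y) <= rnorm x + rnorm y.
Proof.
have := ler_normD x y.
by rewrite [`|x|]rnormE [`|y|]rnormE -rmorphD /= ler_complexR.
Qed.

Lemma rnormN x : rnorm (- x) = rnorm x.
Proof. by rewrite /rnorm normrN. Qed.

Lemma rnormZ (a : R) x : rnorm (a%:C%C *: x) = `|a| * rnorm x.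
Proof. by apply: complexI; rewrite realcM -!rnormE normrZ normr_realc. Qed.

Lemma rdistC x y : rnorm (x - y) = rnorm (y - x).
Proof. by rewrite /rnorm distrC. Qed.

Lemma rdistD y x z : rnorm (x - z) <= rnorm (x - y) + rnorm (y - z).
Proof. by rewrite -{1}(subrK y x) -addrA rnormD. Qed.

Lemma cvg_rnorm (u : nat -> V) l (e : R) : u @ \oo --> l -> 0 < e ->
  exists N, forall p, (N <= p)%N -> rnorm (l - u p) < e.
Proof.
move=> ul e0; have eC : 0 < e%:C%C :> R[i] by rewrite ltcR.
have /cvgrPdist_lt /(_ _ eC)[N _ hN] := ul.
by exists N => p /hN; rewrite /= ltr_complexR.
Qed.

End RealNorm.

Lemma complete_limit (R : realType) (V : completeNormedModType R[i])
    (x : nat -> V) (r : nat -> R) :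
    r @ \oo --> 0 ->
    (forall p q, (p <= q)%N -> rnorm (x q - x p) <= r p) ->
  exists l, forall p, rnorm (l - x p) <= r p.
Proof.
move=> r0 xr.
have cx : cvg (x @ \oo).
  apply/cauchy_cvgP/cauchy_exP => e e0.
  have eE : e = (Re e)%:C%C by rewrite RRe_real // gtr0_real.
  have e0' : 0 < Re e by move: e0; rewrite eE ltcR.
  have /cvgrPdist_lt /(_ _ e0')[p _ hp] := r0.
  exists (x p); exists p => // q /= pq.
  rewrite -ball_normE /= distrC eE ltr_complexR //.
  apply: le_lt_trans (xr _ _ pq) _.
  by have := hp p (leqnn p); rewrite /= sub0r normrN; apply: le_lt_trans (ler_norm _).
have /cvg_ex[l xl] := cx.
exists l => p; apply/ler_addgt0Pr => e e0.
have [q hq] := cvg_rnorm xl e0.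
apply: le_trans (rdistD (x (maxn p q)) _ _) _; rewrite addrC lerD ?xr ?leq_maxl //.
by rewrite ltW // hq // leq_maxr.
Qed.

(** * A Riesz representation theorem for bounded linear relations *)

Section RieszGraph.
Variables (R : realType) (V : completeNormedModType R[i]).
Variable dot : {dot V for Num.conj}.
Hypothesis dotE : forall f, `|f| ^+ 2 = dot f f.

(** The underlying real inner product, enough for a minimization; the imaginary part is recovered by
    testing with i x. *)
Definition rdot (x y : V) : R := Re (dot x y).

Lemma dotC x y : dot x y = (dot y x)^*.
Proof. by rewrite hermC expr0 mul1r. Qed.
Lemma rdotC x y : rdot x y = rdot y x.
Proof. by rewrite /rdot dotC; case: (dot y x). Qed.
Lemma rdotDl x y z : rdot (x + y) z = rdot x z + rdot y z.
Proof. by rewrite /rdot linearDl raddfD. Qed.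
Lemma rdotDr x y z : rdot z (x + y) = rdot z x + rdot z y.
Proof. by rewrite !(rdotC z) rdotDl. Qed.
Lemma rdotZl (a : R) x y : rdot (a%:C%C *: x) y = a * rdot x y.
Proof.
by rewrite /rdot linearZl_LR /=; case: (dot x y) => c d /=; rewrite mul0r subr0.
Qed.
Lemma rdotZr (a : R) x y : rdot x (a%:C%C *: y) = a * rdot x y.
Proof. by rewrite rdotC rdotZl rdotC. Qed.
Lemma rdotNl x y : rdot (- x) y = - rdot x y.
Proof. by rewrite /rdot linearNl raddfN. Qed.
Lemma rdotNr x y : rdot x (- y) = - rdot x y.
Proof. by rewrite rdotC rdotNl rdotC. Qed.
Lemma rdot_ge0 x : 0 <= rdot x x.
Proof. by rewrite /rdot -dotE Re_ge0 // exprn_ge0. Qed.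
Lemma rnorm_sqr x : rnorm x ^+ 2 = rdot x x.
Proof.
by apply: complexI; rewrite rmorphXn /= -rnormE /rdot -dotE RRe_real //.
Qed.


(* [h] is the minimizer of [rdot x x - 2 rdot f y] over the closure of the graph. *)
Lemma riesz_graph (f : V) (c : R) (G : V -> V -> Prop) : 0 < c -> G 0 0 ->
    (forall a x y x' y', G x y -> G x' y' -> G (a *: x + x') (a *: y + y')) ->
    (forall x y, G x y -> rdot y y <= c * rdot x x) ->
  exists h, forall x y, G x y -> dot h x = dot f y.
Proof.
move=> c0 G0 Glin Gle.
pose q x y := rdot x x - 2 * rdot f y.
pose E := [set t | exists x y, G x y /\ t = q x y].
have GZ a x y : G x y -> G (a *: x) (a *: y).
  by move=> Gxy; have := Glin a _ _ _ _ Gxy G0; rewrite !addr0.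
have infE : has_inf E.
  split; first by exists (q 0 0), 0, 0.
  exists (- (c * rdot f f)) => _ [x [y [Gxy ->]]].
  (* Expanding |y - c f|^2 >= 0 and using |y|^2 <= c |x|^2 gives the lower bound. *)
  have := rdot_ge0 (y - c%:C%C *: f); have := Gle _ _ Gxy.
  rewrite !(rdotDl, rdotDr, rdotNl, rdotNr, rdotZl, rdotZr) (rdotC y f) => h1 h2.
  have : 0 <= c * (rdot x x - 2 * rdot f y + c * rdot f f) by nra.
  by rewrite (pmulr_rge0 _ c0) /q; lra.
have qge x y : G x y -> inf E <= q x y.
  by move=> Gxy; apply: ge_inf; [case: infE|exists x, y].
pose eps p : R := (4^-1) ^+ p.
have eps0 p : 0 < eps p by rewrite exprn_gt0 // invr_gt0.
have epsE p : (2^-1) ^+ p * (2^-1) ^+ p = eps p.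
  by rewrite -exprMn -invfM -natrM.
have /choice[xy xyP] : forall p, exists xy : V * V,
    G xy.1 xy.2 /\ q xy.1 xy.2 < inf E + eps p.
  move=> p; have [_ [x [y [Gxy ->]]] lt] := inf_adherent (eps0 p) infE.
  by exists (x, y).
(* Parallelogram identity: the midpoint lies in the graph, so [q] there is at least the infimum, and
   near-minimizers are close to each other. With excess 4^-p their distance is at most 2 * 2^-p. *)
have par x y x' y' : G x y -> G x' y' ->
    rdot (x - x') (x - x') <= 2 * q x y + 2 * q x' y' - 4 * inf E.
  move=> g g'.
  have := qge _ _ (GZ (2^-1)%:C%C _ _ (Glin 1 _ _ _ _ g g')).
  rewrite /q !scale1r.
  rewrite !(rdotDl, rdotDr, rdotNl, rdotNr, rdotZl, rdotZr) (rdotC x' x).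
  by lra.
pose r p : R := 2 * (2^-1) ^+ p.
have r0 : r @ \oo --> 0.
  rewrite -[X in _ --> X](mulr0 2); apply: cvgMr.
  by apply: cvg_expr; rewrite ger0_norm ?invf_lt1 ?invr_ge0 ?ltr1n.
have [h hP] : exists h, forall p, rnorm (h - (xy p).1) <= r p.
  apply: complete_limit r0 _ => p p' pp'.
  rewrite -(@ler_pXn2r _ 2) ?nnegrE ?rnorm_ge0 ?mulr_ge0 ?exprn_ge0 ?invr_ge0 //.
  rewrite rnorm_sqr /r expr2 mulrACA epsE.
  have [g1 q1] := xyP p; have [g2 q2] := xyP p'.
  have := par _ _ _ _ g2 g1.
  have : eps p' <= eps p by rewrite ler_wiXn2l ?invr_ge0 ?invf_le1 ?ler1n.
  by lra.
exists h.
have key x y : G x y -> rdot f y <= rdot h x.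
  move=> Gxy.
  have main t : 0 < t -> 0 <= (rdot h x - rdot f y) + t * rdot x x.
    move=> t0; rewrite -(pmulr_rge0 _ (_ : 0 < 2 * t)) ?mulr_gt0 //.
    (* Near-minimality against the perturbation by t x costs one [eps p]; replacing x_p by its limit
       h costs |x_p - h|^2 <= 4 [eps p], by |x_p - h - t x|^2 >= 0. *)
    have H5 p : 0 <= 5 * eps p +
        2 * t * (rdot h x - rdot f y + t * rdot x x).
      have [g lq] := xyP p.
      have := qge _ _ (Glin t%:C%C _ _ _ _ Gxy g).
      have := rdot_ge0 ((xy p).1 - h - t%:C%C *: x).
      have : rdot ((xy p).1 - h) ((xy p).1 - h) <= 4 * eps p.
        rewrite -rnorm_sqr rdistC -epsE.
        have := hP p; rewrite -(@ler_pXn2r _ 2) ?nnegrE ?rnorm_ge0 //;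
          last by rewrite mulr_ge0 ?exprn_ge0 ?invr_ge0.
        by rewrite /r [in X in _ <= X]expr2 mulrACA -natrM.
      move: lq; rewrite /q.
      rewrite !(rdotDl, rdotDr, rdotNl, rdotNr, rdotZl, rdotZr).
      rewrite !(rdotC x) !(rdotC (xy p).1 h).
      by lra.
    rewrite leNgt; apply/negP => Xlt.
    have : eps @ \oo --> 0.
      by apply: cvg_expr; rewrite ger0_norm ?invf_lt1 ?invr_ge0 ?ltr1n.
    move=> /cvgrPdist_lt /(_ (- (2 * t * (rdot h x - rdot f y + t * rdot x x)) / 5)).
    case=> [|p _ /(_ p (leqnn p)) /=]; first by rewrite divr_gt0 // oppr_gt0.
    rewrite sub0r normrN gtr0_norm // => lt5.
    by have := H5 p; lra.
  rewrite -subr_ge0; apply/ler_addgt0Pr => e e0.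
  have x1 : 0 < 1 + rdot x x by rewrite ltr_pwDl ?rdot_ge0.
  apply: le_trans (main _ (divr_gt0 e0 x1)) _; rewrite lerD2l.
  by rewrite mulrAC ler_pdivrMr // ler_pM2l // lerDr.
(* The reverse inequality is [key] at the opposite pair. *)
have keyE x y : G x y -> rdot h x = rdot f y.
  move=> Gxy; apply/eqP; rewrite eq_le key // andbT.
  by have := key _ _ (GZ (- 1) _ _ Gxy); rewrite !scaleN1r !rdotNr lerN2.
move=> x y Gxy; apply/eqP; rewrite eq_complex; apply/andP; split; apply/eqP.
  exact: keyE.
have := keyE _ _ (GZ 'i%C _ _ Gxy).
rewrite /rdot (dotC h) (dotC f) !linearZl_LR /= (dotC h x) (dotC f y).
by case: (dot x h) => a b; case: (dot y f) => a' b' /=; lra.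
Qed.

End RieszGraph.

(** * Positive kernels *)

(** In the partial order x need not be real beforehand. Since x - a_N is its own modulus, | |x| - x
    | is at most 2 |a_N|, hence 0. *)
Lemma ge0_approx (R : realType) (x : R[i]) (a : nat -> R[i]) :
    (forall N, a N <= x) ->
    (forall e : R, 0 < e -> exists N, Re `|a N| < e) -> 0 <= x.
Proof.
move=> ax a0; suff <- : `|x| = x by [].
apply/eqP; rewrite -subr_eq0 -normr_le0 ler_complexR //.
apply/ler_addgt0Pr => e e0; rewrite add0r.
have [N aN] := a0 _ (divr_gt0 e0 (ltr0Sn R 1)).
have tE : `|x - a N| = x - a N by rewrite ger0_norm // subr_ge0.
have : `| `|x| - x| <= `|a N| + `|a N|.
  have -> : `|x| - x = (`|x| - `|x - a N|) - a N by rewrite tE; ring.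
  apply: le_trans (ler_normB _ _) _; rewrite lerD2r.
  by apply: le_trans (ler_dist_dist _ _) _; rewrite opprB addrC subrK.
by move=> /ler_Re; rewrite ReD; lra.
Qed.

Lemma cvg0_sum (R : realType) (I : Type) (r : seq I) (u : I -> nat -> R) :
  (forall i, u i @ \oo --> 0) -> (fun N => \sum_(i <- r) u i N) @ \oo --> 0.
Proof.
move=> u0; elim: r => [|i r IH].
  rewrite (_ : (fun N => _) = cst 0); first exact: cvg_cst.
  by apply/funext => N; rewrite big_nil.
rewrite (_ : (fun N => _) = u i \+ (fun N => \sum_(j <- r) u j N)).
  by have := cvgD (u0 i) IH; rewrite addr0 => /(_ _); apply.
by apply/funext => N; rewrite big_cons.
Qed.

Section PositiveKernels.
Variables (R : realType) (T : Type).
Local Notation C := R[i].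
Implicit Types (L p : T -> T -> C) (s : seq (C * T)).

(** A list of weighted points stands for a finite combination of kernel functions; points may
    repeat. *)
Definition kernel_form L s : C :=
  \sum_(x <- s) \sum_(y <- s) x.1^* * y.1 * L x.2 y.2.

Definition psd L := forall s, 0 <= kernel_form L s.

(** Positivity expressed through the action on positive kernels: stability under products is then
    mere composition, and no Schur product theorem is required. *)
Definition schur_pos p := forall L, psd L -> psd (fun z w => p z w * L z w).

Lemma eq_psd L L' : (forall z w, L z w = L' z w) -> psd L -> psd L'.
Proof.
move=> E psdL s; have := psdL s; rewrite /kernel_form.
by under eq_bigr do under eq_bigr do rewrite E.
Qed.

Lemma eq_schur_pos p p' : (forall z w, p z w = p' z w) -> schur_pos p -> schur_pos p'.
Proof. by move=> E pp L /pp; apply: eq_psd => z w; rewrite E. Qed.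

Lemma psdD L L' : psd L -> psd L' -> psd (fun z w => L z w + L' z w).
Proof.
move=> pL pL' s; have := addr_ge0 (pL s) (pL' s); rewrite /kernel_form -big_split /=.
under eq_bigr do rewrite -big_split /=.
by under eq_bigr do under eq_bigr do rewrite -mulrDr.
Qed.

Lemma kernel_formB L L' s :
  kernel_form (fun z w => L z w - L' z w) s = kernel_form L s - kernel_form L' s.
Proof.
rewrite /kernel_form -sumrB; apply: eq_bigr => x _; rewrite -sumrB.
by apply: eq_bigr => y _; rewrite mulrBr.
Qed.

Lemma kernel_formZ a L s : kernel_form (fun z w => a * L z w) s = a * kernel_form L s.
Proof.
rewrite /kernel_form mulr_sumr; apply: eq_bigr => x _; rewrite mulr_sumr.
by apply: eq_bigr => y _; rewrite mulrCA.
Qed.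

(** A rank-one factor is absorbed by the weights. *)
Lemma kernel_form_rank1 h L s :
  kernel_form (fun z w => h z * (h w)^* * L z w) s =
  kernel_form L [seq (x.1 * (h x.2)^*, x.2) | x <- s].
Proof.
rewrite /kernel_form !big_map; apply: eq_bigr => x _; rewrite big_map.
by apply: eq_bigr => y _ /=; rewrite rmorphM /= conjCK; ring.
Qed.

Lemma schur_pos_rank1 h : schur_pos (fun z w => h z * (h w)^*).
Proof. by move=> L pL s; rewrite kernel_form_rank1. Qed.

Lemma schur_pos_const (a : C) : 0 <= a -> schur_pos (fun _ _ => a).
Proof.
by move=> a0 L pL s; rewrite kernel_formZ mulr_ge0.
Qed.

Lemma schur_posM p p' : schur_pos p -> schur_pos p' ->
  schur_pos (fun z w => p z w * p' z w).
Proof.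
by move=> pp pp' L pL; apply: eq_psd (pp _ (pp' _ pL)) => z w; rewrite mulrA.
Qed.

Lemma schur_posD p p' : schur_pos p -> schur_pos p' ->
  schur_pos (fun z w => p z w + p' z w).
Proof.
move=> pp pp' L pL; apply: eq_psd (psdD (pp _ pL) (pp' _ pL)) => z w.
by rewrite mulrDl.
Qed.

Lemma schur_pos_sum (I : Type) (r : seq I) (Q : pred I) (p : I -> T -> T -> C) :
  (forall i, Q i -> schur_pos (p i)) -> schur_pos (fun z w => \sum_(i <- r | Q i) p i z w).
Proof.
move=> pp; elim: r => [|i r IH].
  by apply: eq_schur_pos (schur_pos_const (lexx 0)) => z w; rewrite big_nil.
case: (boolP (Q i)) => Qi.
  apply: eq_schur_pos (schur_posD (pp _ Qi) IH) => z w.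
  by rewrite big_cons Qi.
by apply: eq_schur_pos IH => z w; rewrite big_cons (negbTE Qi).
Qed.

Lemma schur_pos_prod (I : Type) (r : seq I) (Q : pred I) (p : I -> T -> T -> C) :
  (forall i, Q i -> schur_pos (p i)) -> schur_pos (fun z w => \prod_(i <- r | Q i) p i z w).
Proof.
move=> pp; elim: r => [|i r IH].
  by apply: eq_schur_pos (schur_pos_const ler01) => z w; rewrite big_nil.
case: (boolP (Q i)) => Qi.
  apply: eq_schur_pos (schur_posM (pp _ Qi) IH) => z w.
  by rewrite big_cons Qi.
by apply: eq_schur_pos IH => z w; rewrite big_cons (negbTE Qi).
Qed.

Lemma schur_posX p k : schur_pos p -> schur_pos (fun z w => p z w ^+ k).
Proof.
move=> pp; elim: k => [|k IH]; first exact: eq_schur_pos (schur_pos_const ler01).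
by apply: eq_schur_pos (schur_posM pp IH) => z w; rewrite exprS.
Qed.

Lemma psd_diag L z : psd L -> 0 <= L z z.
Proof.
by move=> /(_ [:: (1, z)]); rewrite /kernel_form !big_seq1 /= conjC1 !mul1r.
Qed.

Lemma psd1 : psd (fun _ _ => 1).
Proof.
move=> s; rewrite /kernel_form.
under eq_bigr do (under eq_bigr do rewrite mulr1; rewrite -mulr_sumr).
by rewrite -mulr_suml -rmorph_sum /= mulrC mul_conjC_ge0.
Qed.

(* Each entry of the remainder of the geometric series tends to 0. *)
Lemma schur_pos_geometric p : (forall z w, `|p z w| < 1) -> schur_pos p ->
  schur_pos (fun z w => (1 - p z w)^-1).
Proof.
move=> p1 pp L pL s.
pose F N (z w : T) := p z w ^+ N * ((1 - p z w)^-1 * L z w).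
have p_neq z w : 1 - p z w != 0.
  by apply: contraTneq (p1 z w) => /eqP; rewrite subr_eq0 => /eqP <-; rewrite normr1 ltxx.
(* [F 0 - F N] is the product of L with the partial sum 1 + p + ... + p^(N-1), hence positive. *)
have approx N : kernel_form (F N) s <= kernel_form (F 0%N) s.
  rewrite -subr_ge0 -kernel_formB.
  apply: (eq_psd _ (@schur_pos_sum _ (iota 0 N) xpredT _
    (fun k _ => schur_posX k pp) L pL)) => z w.
  rewrite /F !mulrA -mulrBl expr0 -mulrBl; congr (_ * _).
  have /(congr1 -%R) := subrX1 (p z w) N; rewrite opprB => ->.
  rewrite -mulNr opprB mulrAC mulfV // mul1r.
  by rewrite -[X in iota _ X]subn0 -/(index_iota 0 N) big_mkord.
have lim0 e : 0 < e -> exists N, Re `|kernel_form (F N) s| < e.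
  move=> e0.
  pose G N := \sum_(x <- s) \sum_(y <- s)
    Re `|x.1^* * y.1 * ((1 - p x.2 y.2)^-1 * L x.2 y.2)| * Re `|p x.2 y.2| ^+ N.
  have leG N : Re `|kernel_form (F N) s| <= G N.
    rewrite -ler_complexR // /kernel_form realc_sum.
    apply: le_trans (ler_norm_sum _ _ _) (ler_sum _ _) => x _.
    rewrite realc_sum; apply: le_trans (ler_norm_sum _ _ _) (ler_sum _ _) => y _.
    rewrite realcM realcX !normr_ReE -normrX -normrM.
    by rewrite /F mulrCA mulrC.
  have : G @ \oo --> 0.
    apply: cvg0_sum => x; apply: cvg0_sum => y.
    rewrite -[X in _ --> X](mulr0 (Re `|x.1^* * y.1 * ((1 - p x.2 y.2)^-1 * L x.2 y.2)|)).
    apply: cvgMr; apply: cvg_expr.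
    by rewrite ger0_norm ?Re_ge0 // -ltr_complexR.
  move=> /cvgrPdist_lt /(_ _ e0)[N _ /(_ N (leqnn N))] /=.
  rewrite sub0r normrN => lte; exists N.
  exact: le_lt_trans (leG N) (le_lt_trans (ler_norm _) lte).
have := ge0_approx approx lim0; rewrite /kernel_form /F.
by under eq_bigr do under eq_bigr do rewrite expr0 mul1r.
Qed.

End PositiveKernels.

(** * Multipliers *)

Section Multipliers.
Variables (R : realType) (n : nat) (D : set 'rV[R[i]]_n).
Variables (K : 'rV[R[i]]_n -> 'rV[R[i]]_n -> R[i]) (H : rkhs D K).
Local Notation C := R[i].
Local Notation ev := (rkhs_eval H).
Implicit Types (f : H) (g : 'rV[C]_n -> C) (z w : 'rV[C]_n).

Lemma rkhs_evalP (a : C) f f' z : ev (a *: f + f') z = a * ev f z + ev f' z.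
Proof. by rewrite linearP. Qed.

Lemma rkhs_eval_sum (I : Type) (r : seq I) (Q : pred I) (F : I -> H) z :
  ev (\sum_(i <- r | Q i) F i) z = \sum_(i <- r | Q i) ev (F i) z.
Proof. by rewrite linear_sum fct_sumE. Qed.

Lemma rkhs_evalZ (a : C) f z : ev (a *: f) z = a * ev f z.
Proof. by rewrite linearZ. Qed.

Definition multiplier g :=
  forall f, exists h : H, forall z, D z -> ev h z = g z * ev f z.

Lemma mulopE g f z : multiplier g -> D z -> ev (mulop g f) z = g z * ev f z.
Proof.
move=> mg Dz; rewrite /mulop.
by case: xgetP => [h -> /(_ _ Dz) //|noh]; have [h /noh] := mg f.
Qed.

Lemma eq_multiplier g g' : {in D, g =1 g'} -> multiplier g -> multiplier g'.
Proof.
move=> E mg f; have [h hE] := mg f; exists h => z Dz.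
by rewrite hE // E ?inE.
Qed.

Lemma multiplier_cst a : multiplier (cst a).
Proof. by move=> f; exists (a *: f) => z Dz; rewrite rkhs_evalZ. Qed.

Lemma multiplierD g g' : multiplier g -> multiplier g' -> multiplier (g \+ g').
Proof.
move=> mg mg' f; have [h hE] := mg f; have [h' hE'] := mg' f.
by exists (1 *: h + h') => z Dz; rewrite rkhs_evalP mul1r hE // hE' // mulrDl.
Qed.

Lemma multiplierM g g' : multiplier g -> multiplier g' -> multiplier (g \* g').
Proof.
move=> mg mg' f; have [h' hE'] := mg' f; have [h hE] := mg h'.
by exists h => z Dz; rewrite hE // hE' // mulrA.
Qed.

Lemma mulop_linear g : multiplier g -> linear (fun f : H => mulop g f).
Proof.
move=> mg a f f'; apply: rkhs_ext => z Dz.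
by rewrite mulopE // !rkhs_evalP !mulopE //; ring.
Qed.

Lemma mulopC g g' f : multiplier g -> multiplier g' ->
  mulop g (mulop g' f) = mulop g' (mulop g f).
Proof.
by move=> mg mg'; apply: rkhs_ext => z Dz; rewrite !mulopE //; ring.
Qed.

(* The adjoint of the multiplication by [g] sends [K(., w)] to
   [(g w)^* K(., w)]; positivity says that this map is bounded on the span of
   the kernel functions. *)
Lemma psd_multiplier g (c : R) : 0 < c ->
    psd (fun z w : {w | D w} =>
      (c%:C%C - g (sval z) * (g (sval w))^*) * K (sval z) (sval w)) ->
  multiplier g.
Proof.
move=> c0 psdK f.
have /choice[k kP] : forall w : {w | D w}, exists k : H,
    (forall z, D z -> ev k z = K z (sval w)) /\
    (forall f, rkhs_dot H f k = ev f (sval w)).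
  by move=> [w Dw]; have [k k1 k2] := rkhs_reproducing H Dw; exists k.
pose X (s : seq (C * {w | D w})) : H := \sum_(x <- s) x.1 *: k x.2.
pose gs (s : seq (C * {w | D w})) := [seq (x.1 * (g (sval x.2))^*, x.2) | x <- s].
have XE s : rkhs_dot H (X s) (X s) =
    kernel_form (fun z w : {w | D w} => K (sval z) (sval w)) s.
  rewrite /X linear_sumlz /kernel_form exchange_big /=; apply: eq_bigr => x _.
  rewrite linear_sumr; apply: eq_bigr => y _.
  rewrite linearZl_LR linearZr_LR /= (kP _).2 (kP _).1; last exact: svalP.
  by rewrite mulrA [x.1 * _]mulrC.
(* The adjoint is a relation, since a vector may be a combination of kernel functions in several
   ways. *)
pose G x y := exists s, x = X s /\ y = X (gs s).
have Xcat s t : X (s ++ t) = X s + X t by rewrite /X big_cat.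
pose sc a (s : seq (C * {w | D w})) := [seq (a * x.1, x.2) | x <- s].
have Xsc a s : X (sc a s) = a *: X s.
  rewrite /X /sc big_map scaler_sumr; apply: eq_bigr => x _ /=.
  by rewrite scalerA.
have [||x y|h hP] := @riesz_graph R H (rkhs_dot H) (@rkhs_normE _ _ _ _ H) f c G c0.
- by exists [::]; rewrite /X !big_nil.
- move=> a x y x' y' [s [-> ->]] [s' [-> ->]]; exists (sc a s ++ s').
  rewrite /gs map_cat !Xcat !Xsc; split=> //; congr (_ + _).
  rewrite -Xsc; congr X; rewrite /sc -!map_comp; apply: eq_map => x'' /=.
  by rewrite mulrA.
(* By [kernel_form_rank1] the form of g g^* K is |y|^2, so positivity of the form on s says |y|^2 <=
   c |x|^2. *)
- move=> [s [-> ->]].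
  have := eq_psd (fun z w : {w | D w} => mulrBl (K (sval z) (sval w)) c%:C%C
    (g (sval z) * (g (sval w))^*)) psdK s.
  rewrite kernel_formB kernel_formZ.
  rewrite (kernel_form_rank1 (fun z : {w | D w} => g (sval z))) -!XE subr_ge0 => /ler_Re.
  by rewrite /rdot; case: (rkhs_dot H (X s) (X s)) => a b /=; rewrite mul0r subr0.
exists h => w Dw; rewrite -[w in LHS]/(sval (exist _ w Dw)).
rewrite -(kP _).2 (hP _ ((g w)^* *: k (exist _ w Dw))).
  by rewrite linearZr_LR /= conjCK (kP _).2.
exists [:: (1, exist _ w Dw)]; rewrite /X /gs /= !big_seq1 /= scale1r.
by rewrite mul1r.
Qed.

End Multipliers.

(** * Identities between multipliers that give exactness and invertibility *)

Section MultiplierExactness.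
Variables (R : realType) (n : nat) (D : set 'rV[R[i]]_n).
Variables (K : 'rV[R[i]]_n -> 'rV[R[i]]_n -> R[i]) (H : rkhs D K).

(** Multiplication operators commute, so multiplication by the [b j] gives the contracting homotopy
    of [koszul_exact_unit]. *)
Lemma multiplier_resolvent (b : 'I_n -> 'rV[R[i]]_n -> R[i]) (l : 'rV[R[i]]_n) :
    (forall j, multiplier H (fun z => z 0 j)) -> (forall j, multiplier H (b j)) ->
    (forall z, D z -> \sum_j b j z * (z 0 j - l 0 j) = 1) ->
  ~ taylor_spectrum (coord_mulop H) l.
Proof.
move=> mz mb bE; apply.
have mT j : multiplier H (fun z => z 0 j - l 0 j).
  exact: multiplierD (mz j) (multiplier_cst (- l 0 j)).
(* [mulop] is defined by choice; its linearity rests on the proof that g is a multiplier. *)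
pose lin g (mg : multiplier H g) : {linear H -> H} :=
  HB.pack (fun f : H => mulop g f) (GRing.isLinear.Build _ _ _ _ _ (mulop_linear mg)).
have -> : (fun j v => coord_mulop H j v - l 0 j *: v) = (fun j => lin _ (mT j)).
  apply/funext => j; apply/funext => f; apply: rkhs_ext => z Dz.
  rewrite [RHS]mulopE // addrC -scaleNr rkhs_evalP mulopE // mulNr; ring.
apply: (@koszul_exact_unit _ _ _ _ (fun j => lin _ (mb j))) => [j k v|v].
  exact: mulopC.
apply: rkhs_ext => z Dz; rewrite rkhs_eval_sum.
under eq_bigr => j _ do rewrite /= !mulopE // mulrA.
by rewrite -mulr_suml bE // mul1r.
Qed.

(* With [t = 1 + th], [c - q q^*] positive gives [(c - q)(c - q)^* >= d], since
   [(c - q)(c - q)^* - d = t^-1 (c - t q)(c - t q)^* + th (c - q q^* )]. *)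
Lemma inverse_multiplier (q : 'rV[R[i]]_n -> R[i]) (c : R) : 1 < c ->
    (forall z, D z -> K z z != 0) ->
    psd (fun z w : {w | D w} => K (sval z) (sval w)) ->
    psd (fun z w : {w | D w} =>
      (c%:C%C - q (sval z) * (q (sval w))^*) * K (sval z) (sval w)) ->
  (forall z, D z -> c%:C%C - q z != 0) /\ multiplier H (fun z => (c%:C%C - q z)^-1).
Proof.
move=> c1 K0 pK pq.
(* 1 + th is the midpoint of 1 and c, so c / (1 + th) > 1 and d > 0. *)
pose th : R := (c - 1) / 2.
have th0 : 0 < th by rewrite divr_gt0 ?subr_gt0.
pose d : R := th * c * (c / (1 + th) - 1).
have c0 : 0 < c by lra.
have thc : 1 + th < c by rewrite /th; lra.
have th1 : 0 < 1 + th by lra.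
have d0 : 0 < d.
  have : 0 < c / (1 + th) - 1 by rewrite subr_gt0 ltr_pdivlMr // mul1r.
  by apply: mulr_gt0; apply: mulr_gt0.
have [t tD] : exists t : R[i], t = (1 + th)%:C%C by exists (1 + th)%:C%C.
have t0 : t != 0 by rewrite tD gt_eqF // ltcR.
have tV : ((1 + th)^-1)%:C%C = t^-1 by rewrite tD fmorphV.
have tE : th%:C%C = t - 1 by rewrite tD rmorphD rmorph1 addrAC subrr add0r.
have dE : d%:C%C = (t - 1) * c%:C%C * (c%:C%C / t - 1).
  by rewrite -tE -tV /d 2!realcM realcB realcM.
have pM : psd (fun z w : {w | D w} =>
    ((c%:C%C - q (sval z)) * (c%:C%C - q (sval w))^* - d%:C%C) * K (sval z) (sval w)).
  pose h (z : {w | D w}) := c%:C%C - (1 + th)%:C%C * q (sval z).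
  have inv0 : 0 <= ((1 + th)^-1)%:C%C :> R[i] by rewrite ler0c invr_ge0 ltW.
  have th0C : 0 <= th%:C%C :> R[i] by rewrite ler0c ltW.
  apply: eq_psd (psdD (schur_pos_const inv0 (schur_pos_rank1 h pK))
    (schur_pos_const th0C pq)) => z w.
  rewrite /h !rmorphB rmorphM /= !realc_conj tV tE dE -tD.
  by field.
have Kpos z : D z -> 0 < K z z.
  move=> Dz; rewrite lt_def K0 //=.
  exact: (psd_diag (exist _ z Dz) pK).
have M0 z : D z -> c%:C%C - q z != 0.
  (* A zero of c - q would make the diagonal entry of [pM] equal to -d K(z,z) < 0. *)
  move=> Dz; apply: contraTneq (psd_diag (exist _ z Dz) pM) => /= ->.
  by rewrite mul0r sub0r mulNr oppr_ge0 lt_geF // mulr_gt0 ?Kpos // ltcR.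
split=> //.
apply: (@psd_multiplier _ _ _ _ _ _ (d^-1)); first by rewrite invr_gt0.
have inv0 : 0 <= (d^-1)%:C%C :> R[i] by rewrite ler0c invr_ge0 ltW.
pose h (z : {w | D w}) := (c%:C%C - q (sval z))^-1.
apply: eq_psd (schur_pos_const inv0 (schur_pos_rank1 h pM)).
move=> [z Dz] [w Dw]; rewrite /h /=.
have := M0 z Dz; have := M0 w Dw; rewrite !fmorphV rmorphB /= realc_conj.
have d0C : d%:C%C != 0 :> R[i] by rewrite gt_eqF // ltcR.
rewrite -(conjC_eq0 (_ - q w)) rmorphB /= realc_conj.
move=> Mw Mz; field.
by rewrite Mw Mz d0C.
Qed.

End MultiplierExactness.

(** * The triangle kernel *)

Section PolynomialKernels.
Variables (R : realType) (n : nat).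
Local Notation C := R[i].
Implicit Types (p : mpoly n C) (u v : 'rV[C]_n) (m : multinom n).

Definition monom u m : C := \prod_i u 0 i ^+ m i.

Definition poly_ker p u v : C := poly_at p (diamond u (conjv v)).

Definition nonneg_coef p := forall m, 0 <= mcoeff m p.

Lemma poly_kerE p u v :
  poly_ker p u v = \sum_(m <- msupp p) mcoeff m p * (monom u m * (monom v m)^*).
Proof.
rewrite /poly_ker /poly_at mevalE; apply: eq_bigr => m _; congr (_ * _).
rewrite /monom rmorph_prod /= -big_split /=; apply: eq_bigr => i _.
by rewrite !mxE exprMn rmorphXn.
Qed.

Lemma schur_pos_poly (T : Type) (F : T -> 'rV[C]_n) p : nonneg_coef p ->
  schur_pos (fun z w => poly_ker p (F z) (F w)).
Proof.
move=> p0; apply: (@eq_schur_pos _ _ (fun z w => \sum_(m <- msupp p)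
  mcoeff m p * (monom (F z) m * (monom (F w) m)^*))).
  by move=> z w; rewrite poly_kerE.
apply: schur_pos_sum => m _; apply: schur_posM; first exact: schur_pos_const.
exact: (schur_pos_rank1 (fun z => monom (F z) m)).
Qed.

Lemma poly_ker_ge0 p u : nonneg_coef p -> 0 <= poly_ker p u u.
Proof.
by move=> p0; rewrite poly_kerE sumr_ge0 // => m _; rewrite mulr_ge0 ?p0 ?mul_conjC_ge0.
Qed.

(* [2 |u^m v^m| <= |u^m|^2 + |v^m|^2] *)
Lemma poly_ker_norm_lt1 p u v : nonneg_coef p ->
  poly_ker p u u < 1 -> poly_ker p v v < 1 -> `|poly_ker p u v| < 1.
Proof.
move=> p0 u1 v1; rewrite -(@ltr_pM2l _ 2) // mulr1.
apply: le_lt_trans (_ : poly_ker p u u + poly_ker p v v < 2); last first.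
  by rewrite (_ : 2 = 1 + 1) // ltrD.
rewrite !poly_kerE -big_split /=.
apply: le_trans (ler_wpM2l _ (ler_norm_sum _ _ _)) _ => //.
rewrite mulr_sumr ler_sum // => m _.
rewrite !normrM norm_conjC ger0_norm ?p0 // -mulrDr mulrCA ler_wpM2l ?p0 //.
rewrite -!normCK -subr_ge0.
have -> : `|monom u m| ^+ 2 + `|monom v m| ^+ 2 - 2 * (`|monom u m| * `|monom v m|)
  = (`|monom u m| - `|monom v m|) ^+ 2 by ring.
by rewrite real_exprn_even_ge0 // realB // normr_real.
Qed.

(* Lagrange's identity, as in the proof of the Cauchy-Schwarz inequality. *)
Lemma schur_pos_gram (T : Type) (F : T -> 'rV[C]_n) p v : nonneg_coef p ->
  schur_pos (fun z w => poly_ker p v v * poly_ker p (F z) (F w)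
    - poly_ker p (F z) v * (poly_ker p (F w) v)^*).
Proof.
move=> p0.
pose h a b z := monom (F z) a * monom v b - monom (F z) b * monom v a.
apply: (@eq_schur_pos _ _ (fun z w => \sum_(a <- msupp p) \sum_(b <- msupp p)
  2^-1 * mcoeff a p * mcoeff b p * (h a b z * (h a b w)^*))); last first.
  apply: schur_pos_sum => a _; apply: schur_pos_sum => b _.
  apply: schur_posM; last exact: schur_pos_rank1.
  by apply: schur_pos_const; rewrite !mulr_ge0 ?invr_ge0.
move=> z w.
(* Each Lagrange square is [f a b + f b a], so the double sum counts [f] twice and the factor 1/2
   disappears. *)
pose f (a b : multinom n) := mcoeff a p * mcoeff b p *
   (monom (F z) a * (monom (F w) a)^* * (monom v b * (monom v b)^*)
   - monom (F z) a * (monom v a)^* * ((monom (F w) b)^* * monom v b)).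
transitivity (2^-1 * (\sum_(a <- msupp p) \sum_(b <- msupp p) (f a b + f b a))).
  rewrite mulr_sumr; apply: eq_bigr => a _; rewrite mulr_sumr; apply: eq_bigr => b _.
  by rewrite /h /f !(rmorphB, rmorphM) /=; ring.
under eq_bigr do rewrite big_split /=.
rewrite big_split /= [X in _ + X]exchange_big /= -mulr2n.
rewrite -[X in _ * X]mulr_natl mulKf ?pnatr_eq0 //.
have real_coef m : (mcoeff m p)^* = mcoeff m p.
  by apply/CrealP; rewrite ger0_real.
rewrite !poly_kerE rmorph_sum /= mulrC !mulr_suml -sumrB.
apply: eq_bigr => a _; rewrite !mulr_sumr -sumrB; apply: eq_bigr => b _.
by rewrite /f !rmorphM /= conjCK real_coef; ring.
Qed.

Lemma positive_regular_nonneg (P : 'I_n -> mpoly n C) j :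
  positive_regular P -> nonneg_coef (P j).
Proof. by move=> /(_ j)[]. Qed.

(** The homogeneous parts of degree at least 2 do not meet the coefficient of z_j, so removing the
    linear term leaves nonnegative coefficients. *)
Lemma positive_regularP (P : 'I_n -> mpoly n C) j : positive_regular P ->
  exists2 a : R, 0 < a & exists2 Q, nonneg_coef Q &
    P j = a%:C%C *: mpolyX C (mnm1 j) + Q.
Proof.
move=> /(_ j)[P0 [a [N [Q [a0 homQ PE]]]]].
exists (Re a); first by rewrite -ltcR RRe_real // gtr0_real.
have aE : (Re a)%:C%C = a by rewrite RRe_real // gtr0_real.
exists (\sum_(2 <= k < N.+1) Q k); last by rewrite aE.
move=> m; have := P0 m; rewrite PE mcoeffD mcoeffZ mcoeffX.
case: eqP => [<- _|_]; last by rewrite mulr0 add0r.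
rewrite (_ : mcoeff _ _ = 0) // raddf_sum /= big_nat_cond big1 // => k.
rewrite andbT => /andP[k2 _].
by rewrite (dhomog_nemf_coeff (homQ k)) //= mdeg1 neq_ltn k2.
Qed.

Lemma positive_regular_coef0 (P : 'I_n -> mpoly n C) j :
  positive_regular P -> mcoeff mnm0 (P j) = 0.
Proof.
move=> /(_ j)[_ [a [N [Q [_ homQ ->]]]]].
rewrite mcoeffD mcoeffZ mcoeffX mnm1_eq0 mulr0 add0r raddf_sum /= big_nat_cond.
rewrite big1 // => k; rewrite andbT => /andP[k2 _].
by rewrite (dhomog_nemf_coeff (homQ k)) //= mdeg0 neq_ltn (ltn_trans _ k2).
Qed.

Lemma monom_scale (a : C) u m : monom (a *: u) m = a ^+ mdeg m * monom u m.
Proof.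
rewrite /monom mdegE -prodrXr -big_split /=; apply: eq_bigr => i _.
by rewrite mxE exprMn.
Qed.

(** Without constant term, each monomial is scaled by t^(2 deg) <= t. *)
Lemma poly_ker_scale p u (t : R) : nonneg_coef p -> mcoeff mnm0 p = 0 ->
  0 <= t <= 1 ->
  poly_ker p (t%:C%C *: u) (t%:C%C *: u) <= t%:C%C * poly_ker p u u.
Proof.
move=> p0 p00 /andP[t0 t1]; rewrite !poly_kerE mulr_sumr ler_sum // => m _.
rewrite !monom_scale rmorphM /= mulrACA mulrCA -!realcX realc_conj.
have := p0 m; have [m0|m0 _] := eqVneq (mdeg m) 0%N.
  by move/eqP: m0; rewrite mdeg_eq0 => /eqP ->; rewrite p00 !mul0r !mulr0.
rewrite -realcM; set s := (_ * _)%:C%C.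
have -> : mcoeff m p * (monom u m * (s * (monom u m)^*)) =
  s * (mcoeff m p * (monom u m * (monom u m)^*)) by ring.
apply: ler_wpM2r; first by rewrite mulr_ge0 ?mul_conjC_ge0.
rewrite /s lecR.
rewrite -(prednK (_ : 0 < mdeg m)%N) ?lt0n // exprS -mulrA ler_piMr //.
have te : t ^+ (mdeg m).-1 <= 1 by rewrite exprn_ile1.
by rewrite mulr_ile1 ?mulr_ge0 ?exprn_ge0 // mulr_ile1 // exprn_ge0.
Qed.

End PolynomialKernels.

Section TriangleKernel.
Variables (R : realType) (n : nat) (P : 'I_n -> mpoly n R[i]).
Variables (m : 'I_n -> nat).
Hypothesis hP : positive_regular P.
Local Notation C := R[i].
Local Notation D := (triangle P).
Local Notation K := (triangle_kernel P m).

Definition triangle_ker j z w : C := poly_ker (P j) (phi z) (phi w).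

Lemma triangle_ker_norm_lt1 j z w : D z -> D w -> `|triangle_ker j z w| < 1.
Proof.
move=> [_ z1] [_ w1]; apply: poly_ker_norm_lt1 (z1 j) (w1 j).
exact: positive_regular_nonneg.
Qed.

Lemma triangle_kernelE z w : K z w =
  (\prod_(j < n | (0 < j)%N) (z 0 j)^-1) * (\prod_(j < n | (0 < j)%N) (w 0 j)^-1)^* *
  \prod_j (1 - triangle_ker j z w)^-1 ^+ m j.
Proof.
rewrite /triangle_kernel rmorph_prod -big_split /=; congr (_ * _).
  by apply: eq_bigr => j _; rewrite invfM fmorphV.
by apply: eq_bigr => j _; rewrite exprVn.
Qed.

Lemma schur_pos_triangle_ker j :
  schur_pos (fun z w : {w | D w} => triangle_ker j (sval z) (sval w)).
Proof.
apply: (schur_pos_poly (fun z : {w | D w} => phi (sval z))).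
exact: positive_regular_nonneg.
Qed.

Lemma schur_pos_factor j :
  schur_pos (fun z w : {w | D w} => (1 - triangle_ker j (sval z) (sval w))^-1).
Proof.
apply: schur_pos_geometric (schur_pos_triangle_ker j).
by move=> [z Dz] [w Dw]; apply: triangle_ker_norm_lt1.
Qed.

Lemma triangle_ker_neq1 j z w : D z -> D w -> 1 - triangle_ker j z w != 0.
Proof.
move=> Dz Dw; apply: contraTneq (triangle_ker_norm_lt1 j Dz Dw) => /eqP.
by rewrite subr_eq0 => /eqP <-; rewrite normr1 ltxx.
Qed.

Let pre (z : {w | D w}) : C := \prod_(j < n | (0 < j)%N) (sval z 0 j)^-1.

Lemma psd_triangle_kernel : psd (fun z w : {w | D w} => K (sval z) (sval w)).
Proof.
have := schur_posM (schur_pos_rank1 pre)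
  (schur_pos_prod (index_enum 'I_n) (Q := xpredT)
    (fun j _ => schur_posX (m j) (schur_pos_factor j))).
move=> /(_ _ (@psd1 _ _)); apply: eq_psd => z w.
by rewrite mulr1 triangle_kernelE.
Qed.

(** The factor 1 - P_j cancels one of the m_j copies of its inverse and leaves a product of positive
    kernels. *)
Lemma psd_triangle_kernelB j : (0 < m j)%N ->
  psd (fun z w : {w | D w} =>
    (1 - triangle_ker j (sval z) (sval w)) * K (sval z) (sval w)).
Proof.
move=> mj.
have := schur_posM (schur_posM (schur_pos_rank1 pre)
  (schur_posX (m j).-1 (schur_pos_factor j)))
  (schur_pos_prod (index_enum 'I_n) (Q := fun i => i != j)
    (fun i _ => schur_posX (m i) (schur_pos_factor i))).
move=> /(_ _ (@psd1 _ _)); apply: eq_psd => -[z Dz] [w Dw] /=.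
rewrite mulr1 triangle_kernelE [in RHS](@bigD1 _ _ _ _ j xpredT) //=.
have [k ->] : exists k, m j = k.+1 by exists (m j).-1; rewrite prednK.
rewrite exprS /pre /=; move: (triangle_ker_neq1 j Dz Dw).
move: (1 - triangle_ker j z w) (bigop _ _ _) (_^*) (bigop _ _ _) => e A A' B e0.
by rewrite exprVn; field; rewrite expf_neq0.
Qed.

Lemma triangle_kernel_neq0 z : D z -> K z z != 0.
Proof.
move=> Dz; have [z0 _] := Dz.
have pz : \prod_(j < n | (0 < j)%N) (z 0 j)^-1 != 0.
  by rewrite prodf_seq_neq0; apply/allP => j _; apply/implyP => j0; rewrite invr_eq0 z0.
rewrite triangle_kernelE !mulf_neq0 ?conjC_eq0 //.
by apply/prodf_neq0 => j _; rewrite expf_neq0 // invr_eq0 triangle_ker_neq1.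
Qed.

End TriangleKernel.

(** * Upper bound of the spectrum *)

Section MultiplierIdeal.
Variables (R : realType) (n : nat) (D : set 'rV[R[i]]_n).
Variables (K : 'rV[R[i]]_n -> 'rV[R[i]]_n -> R[i]) (H : rkhs D K).
Variable (l : 'rV[R[i]]_n).
Local Notation C := R[i].
Implicit Types g h : 'rV[C]_n -> C.

Definition in_ideal g := exists2 b : 'I_n -> 'rV[C]_n -> C,
  forall j, multiplier H (b j) &
  forall z, D z -> g z = \sum_j b j z * (z 0 j - l 0 j).

Lemma eq_in_ideal g h : (forall z, D z -> g z = h z) -> in_ideal g -> in_ideal h.
Proof. by move=> E [b mb gE]; exists b => // z Dz; rewrite -E ?gE. Qed.

Lemma in_idealD g h : in_ideal g -> in_ideal h -> in_ideal (g \+ h).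
Proof.
move=> [b mb gE] [b' mb' hE]; exists (fun j => b j \+ b' j) => [j|z Dz].
  exact: multiplierD.
rewrite /= gE // hE // -big_split /=.
by apply: eq_bigr => j _; rewrite mulrDl.
Qed.

Lemma in_idealM g h : multiplier H g -> in_ideal h -> in_ideal (g \* h).
Proof.
move=> mg [b mb hE]; exists (fun j => g \* b j) => [j|z Dz]; first exact: multiplierM.
rewrite /= hE // mulr_sumr.
by apply: eq_bigr => j _; rewrite mulrA.
Qed.

Lemma in_ideal_gen j : in_ideal (fun z => z 0 j - l 0 j).
Proof.
exists (fun i => cst (i == j)%:R) => [i|z Dz]; first exact: multiplier_cst.
by rewrite (bigD1 j) //= eqxx mul1r big1 ?addr0 // => i /negbTE ->; rewrite mul0r.
Qed.

Lemma in_ideal0 : in_ideal (cst 0).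
Proof.
exists (fun=> cst 0) => [j|z _]; first exact: multiplier_cst.
by rewrite big1 // => j _; rewrite mul0r.
Qed.

Lemma ideal_unit_resolvent : (forall j, multiplier H (fun z => z 0 j)) ->
  in_ideal (cst 1) -> ~ taylor_spectrum (coord_mulop H) l.
Proof.
by move=> mz [b mb bE]; apply: (multiplier_resolvent mz mb) => z /bE <-.
Qed.

(** Requiring both sides to be multipliers makes the congruence stable under products, hence under
    polynomials. *)
Definition ideal_eqmod g h :=
  [/\ multiplier H g, multiplier H h & in_ideal (g \- h)].

Lemma ideal_eqmod_refl g : multiplier H g -> ideal_eqmod g g.
Proof. by move=> mg; split=> //; apply: eq_in_ideal in_ideal0 => z _; rewrite /= subrr. Qed.

Lemma ideal_eqmodD g h g' h' : ideal_eqmod g h -> ideal_eqmod g' h' ->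
  ideal_eqmod (g \+ g') (h \+ h').
Proof.
move=> [mg mh gh] [mg' mh' gh']; split; [exact: multiplierD|exact: multiplierD|].
by apply: eq_in_ideal (in_idealD gh gh') => z _ /=; ring.
Qed.

Lemma ideal_eqmodM g h g' h' : ideal_eqmod g h -> ideal_eqmod g' h' ->
  ideal_eqmod (g \* g') (h \* h').
Proof.
move=> [mg mh gh] [mg' mh' gh']; split; [exact: multiplierM|exact: multiplierM|].
by apply: eq_in_ideal (in_idealD (in_idealM mg gh') (in_idealM mh' gh)) => z _ /=; ring.
Qed.

Lemma ideal_eqmodX g h k : ideal_eqmod g h ->
  ideal_eqmod (fun z => g z ^+ k) (fun z => h z ^+ k).
Proof.
move=> gh; elim: k => [|k IH]; first exact: ideal_eqmod_refl (multiplier_cst 1).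
have E (f : 'rV[C]_n -> C) : (fun z => f z ^+ k.+1) = f \* (fun z => f z ^+ k).
  by apply/funext => z; rewrite /= exprS.
by rewrite !E; apply: ideal_eqmodM.
Qed.

Lemma ideal_eqmod_sum (I : Type) (r : seq I) (g h : I -> 'rV[C]_n -> C) :
  (forall i, ideal_eqmod (g i) (h i)) ->
  ideal_eqmod (fun z => \sum_(i <- r) g i z) (fun z => \sum_(i <- r) h i z).
Proof.
move=> gh; elim: r => [|i r IH].
  have E (f : I -> 'rV[C]_n -> C) : (fun z => \sum_(i <- [::]) f i z) = cst 0.
    by apply/funext => z; rewrite big_nil.
  by rewrite !E; apply: ideal_eqmod_refl (multiplier_cst 0).
have E (f : I -> 'rV[C]_n -> C) :
    (fun z => \sum_(i <- i :: r) f i z) = f i \+ (fun z => \sum_(i <- r) f i z).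
  by apply/funext => z; rewrite big_cons.
by rewrite !E; apply: ideal_eqmodD.
Qed.

Lemma ideal_eqmod_prod (I : Type) (r : seq I) (g h : I -> 'rV[C]_n -> C) :
  (forall i, ideal_eqmod (g i) (h i)) ->
  ideal_eqmod (fun z => \prod_(i <- r) g i z) (fun z => \prod_(i <- r) h i z).
Proof.
move=> gh; elim: r => [|i r IH].
  have E (f : I -> 'rV[C]_n -> C) : (fun z => \prod_(i <- [::]) f i z) = cst 1.
    by apply/funext => z; rewrite big_nil.
  by rewrite !E; apply: ideal_eqmod_refl (multiplier_cst 1).
have E (f : I -> 'rV[C]_n -> C) :
    (fun z => \prod_(i <- i :: r) f i z) = f i \* (fun z => \prod_(i <- r) f i z).
  by apply/funext => z; rewrite big_cons.
by rewrite !E; apply: ideal_eqmodM.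
Qed.

Lemma ideal_eqmod_meval (p : mpoly n C) (g h : 'I_n -> 'rV[C]_n -> C) :
  (forall i, ideal_eqmod (g i) (h i)) ->
  ideal_eqmod (fun z => meval (fun i => g i z) p) (fun z => meval (fun i => h i z) p).
Proof.
move=> gh.
have E (f : 'I_n -> 'rV[C]_n -> C) : (fun z => meval (fun i => f i z) p) =
    (fun z => \sum_(m <- msupp p) (cst (mcoeff m p) \* (fun z => \prod_i f i z ^+ m i)) z).
  by apply/funext => z; rewrite mevalE.
rewrite !E; apply: ideal_eqmod_sum => m; apply: ideal_eqmodM.
  exact: ideal_eqmod_refl (multiplier_cst _).
by apply: ideal_eqmod_prod => i; apply: ideal_eqmodX.
Qed.

End MultiplierIdeal.

(** * Multipliers on the triangle and points outside the spectrum *)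

Section TriangleSpectrum.
Variables (R : realType) (n : nat) (P : 'I_n -> mpoly n R[i]).
Variables (m : 'I_n -> nat).
Hypothesis hP : positive_regular P.
Hypothesis hm : forall j, (1 <= m j)%N.
Variable H : rkhs (triangle P) (triangle_kernel P m).
Local Notation C := R[i].
Local Notation D := (triangle P).
Local Notation K := (triangle_kernel P m).

(** With P_j = a z_j + Q one has a^-1 - u_j u'_j^* = a^-1 ((1 - P_j) + Q), and both summands times K
    are positive. *)
Lemma multiplier_phi j : multiplier H (fun z => phi z 0 j).
Proof.
have [a a0 [Q Q0 PE]] := positive_regularP j hP.
have a0C : a%:C%C != 0 :> C by rewrite gt_eqF // ltcR.
apply: (@psd_multiplier _ _ _ _ _ _ a^-1); first by rewrite invr_gt0.
have inv0 : 0 <= (a^-1)%:C%C :> C by rewrite ler0c invr_ge0 ltW.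
have psdQ := schur_pos_poly (fun z : {w | D w} => phi (sval z)) Q0
  (psd_triangle_kernel m hP).
apply: eq_psd (schur_pos_const inv0 (psdD (psd_triangle_kernelB hP (hm j)) psdQ)) => z w.
rewrite fmorphV /= -mulrDl mulrA; congr (_ * _).
have -> : triangle_ker P j (sval z) (sval w) =
    a%:C%C * (phi (sval z) 0 j * (phi (sval w) 0 j)^*) +
    poly_ker Q (phi (sval z)) (phi (sval w)).
  rewrite /triangle_ker /poly_ker /poly_at PE mevalD mevalZ mevalXU.
  by rewrite [diamond _ _ 0 j]mxE [conjv _ 0 j]mxE.
by field.
Qed.

Lemma phi_last z (j : 'I_n) : ~~ (j.+1 < n)%N -> phi z 0 j = z 0 j :> C.
Proof. by move=> /negbTE jn; rewrite mxE jn. Qed.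

Lemma phi_lt z (j : 'I_n) : (j.+1 < n)%N -> phi z 0 j = z 0 j / z 0 (ordS j) :> C.
Proof. by move=> jn; rewrite mxE jn. Qed.

Lemma phi_mul z (j : 'I_n) : D z -> (j.+1 < n)%N -> phi z 0 j * z 0 (ordS j) = z 0 j.
Proof.
by move=> [z0 _] jn; rewrite phi_lt // mulfVK // z0 //= modn_small.
Qed.

Lemma multiplier_coord j : multiplier H (fun z => z 0 j).
Proof.
(* Induction from the last coordinate downwards, through z_j = u_j z_(j+1). *)
have [k] := ubnP (n - j); elim: k j => // k IH j jk.
have [jn|jn] := boolP (j.+1 < n)%N; last first.
  by apply: eq_multiplier (multiplier_phi j) => z _; apply: phi_last.
have mS : multiplier H (fun z => z 0 (ordS j)).
  apply: IH; rewrite /= modn_small //.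
  by rewrite subnS prednK // subn_gt0.
apply: eq_multiplier (multiplierM (multiplier_phi j) mS) => z.
by rewrite inE => Dz; apply: phi_mul.
Qed.

(* Junk value: [phi l 0 j = 0] when [l 0 (ordS j) = 0] and [j + 1 < n]. *)
Definition closed_triangle : set 'rV[C]_n :=
  [set l : 'rV[C]_n |
    (forall j : 'I_n, (j.+1 < n)%N -> l 0 (ordS j) = 0 -> l 0 j = 0) /\
    forall j, poly_ker (P j) (phi l) (phi l) <= 1].

Lemma in_ideal_coord0 (l : 'rV[C]_n) (j : 'I_n) : (j.+1 < n)%N ->
  l 0 (ordS j) = 0 -> l 0 j != 0 -> in_ideal H l (cst 1).
Proof.
move=> jn lS lj.
have := in_idealD (in_idealM (multiplier_phi j) (@in_ideal_gen _ _ _ _ H l (ordS j)))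
  (in_idealM (multiplier_cst (-1)) (@in_ideal_gen _ _ _ _ H l j)).
move=> /(in_idealM (multiplier_cst (l 0 j)^-1)); apply: eq_in_ideal => z Dz /=.
by rewrite lS subr0 phi_mul // mulN1r opprB addrCA subrr addr0 mulVf.
Qed.

(** The factor [(phi l 0 i)^*] makes the congruence trivial when [phi l 0 i = 0], in particular at
    the junk value of a division by zero. *)
Lemma phi_eqmod (l : 'rV[C]_n) (i : 'I_n) :
  ideal_eqmod H l (fun z => phi z 0 i * (phi l 0 i)^*)
                  (cst (phi l 0 i * (phi l 0 i)^*)).
Proof.
have mi := multiplierM (multiplier_phi i) (multiplier_cst (phi l 0 i)^*).
split=> //; first exact: multiplier_cst.
have [u0|u0] := eqVneq (phi l 0 i) 0.
  apply: eq_in_ideal (@in_ideal0 _ _ _ _ H l) => z _ /=.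
  by rewrite u0 conjC0 !mulr0 subrr.
have [jn|jn] := boolP (i.+1 < n)%N; last first.
  apply: eq_in_ideal (in_idealM (multiplier_cst (phi l 0 i)^*)
    (@in_ideal_gen _ _ _ _ H l i)).
  by move=> z Dz /=; rewrite !phi_last //; ring.
have lS : l 0 (ordS i) != 0.
  by apply: contraNneq u0 => lS; rewrite phi_lt // lS invr0 mulr0.
(* u_i (z_(i+1) - l_(i+1)) - (z_i - l_i) equals -l_(i+1) (u_i - l_i / l_(i+1)). *)
have := in_idealD (in_idealM (multiplier_phi i) (@in_ideal_gen _ _ _ _ H l (ordS i)))
  (in_idealM (multiplier_cst (-1)) (@in_ideal_gen _ _ _ _ H l i)).
move=> /(in_idealM (multiplier_cst (- (phi l 0 i)^* / l 0 (ordS i)))).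
apply: eq_in_ideal => z Dz /=.
move: (_^*) => y; rewrite -(phi_mul Dz jn) [phi l 0 i]phi_lt //.
by field.
Qed.

Lemma in_ideal_poly (l : 'rV[C]_n) (j : 'I_n) (c : R) :
  poly_ker (P j) (phi l) (phi l) = c%:C%C -> 1 < c -> in_ideal H l (cst 1).
Proof.
move=> cE c1.
have P0 := positive_regular_nonneg j hP.
pose q z := poly_ker (P j) (phi z) (phi l).
have pK := psd_triangle_kernel m hP.
have pq : psd (fun z w : {w | D w} =>
    (c%:C%C - q (sval z) * (q (sval w))^*) * K (sval z) (sval w)).
  have c0C : 0 <= c%:C%C :> C by rewrite -cE poly_ker_ge0.
  apply: eq_psd (psdD (schur_pos_const c0C (psd_triangle_kernelB hP (hm j)))
    (schur_pos_gram (fun z : {w | D w} => phi (sval z)) (phi l) P0 pK)) => z w.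
  by rewrite /q /triangle_ker cE; ring.
have K0 := triangle_kernel_neq0 m hP.
have [M0 mM] := inverse_multiplier H c1 K0 pK pq.
have [_ _] := ideal_eqmod_meval (P j) (phi_eqmod l).
move=> /(in_idealM (multiplierM (multiplier_cst (-1)) mM)).
apply: eq_in_ideal => z Dz /=.
have qE (u : 'rV[C]_n) : poly_ker (P j) u (phi l) =
    meval (fun i => u 0 i * (phi l 0 i)^*) (P j).
  by apply: meval_eq => i; rewrite !mxE.
rewrite -!qE cE -/(q z).
by rewrite -(opprB _ (q z)) mulN1r mulrNN mulVf ?M0.
Qed.

Lemma taylor_spectrum_sub : taylor_spectrum (coord_mulop H) `<=` closed_triangle.
Proof.
move=> l sp; split=> [j jn lS|j].
  apply/eqP/contraT => lj.
  by case: (ideal_unit_resolvent multiplier_coord (in_ideal_coord0 jn lS lj)).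
have P0 := positive_regular_nonneg j hP.
have c0 := poly_ker_ge0 (phi l) P0.
rewrite -[1]/(1%:C%C) ler_complexR // leNgt; apply/negP => c1.
have cE : poly_ker (P j) (phi l) (phi l) = (Re (poly_ker (P j) (phi l) (phi l)))%:C%C.
  by rewrite RRe_real // ger0_real.
by case: (ideal_unit_resolvent multiplier_coord (in_ideal_poly cE c1)).
Qed.

End TriangleSpectrum.

(** * Lower bound of the spectrum *)

Section RowConvergence.
Variables (R : realType) (n : nat).
Local Notation C := R[i].

Lemma cvg_row (T : Type) (F : set_system T) (FF : Filter F) (f : T -> 'rV[C]_n)
    (l : 'rV[C]_n) :
  (forall j, f x 0 j @[x --> F] --> (l 0 j : C)) -> f @ F --> l.
Proof.
move=> fl A [Q nQ sQA].
have : \forall x \near F, forall j, Q 0 j (f x 0 j).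
  by apply: filter_forall => j; apply: fl.
by apply: filterS => x Qx; apply: sQA => i j; rewrite ord1.
Qed.

Lemma closure_dist (A : set 'rV[C]_n) l (e : R) : closure A l -> 0 < e ->
  exists2 z, A z & forall j, `|z 0 j - l 0 j| < e%:C%C.
Proof.
move=> cl e0; have eC : 0 < e%:C%C :> C by rewrite ltcR.
have [|z [Az zl]] := cl [set z : 'rV[C]_n | forall j, `|z 0 j - l 0 j| < e%:C%C].
  exists (fun i j => ball (l 0 j) e%:C%C) => [i j|z /= zl j].
    by rewrite ord1; apply: nbhsx_ballx.
  by have := zl 0 j; rewrite -ball_normE /= distrC.
by exists z.
Qed.

Lemma cvg_realc (T : Type) (F : set_system T) (FF : Filter F) (f : T -> R) (a : R) :
  f @ F --> a -> (f x)%:C%C @[x --> F] --> (a%:C%C : C).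
Proof.
move=> fa; apply/cvgrPdist_lt => e e0.
have eE : e = (Re e)%:C%C by rewrite RRe_real // gtr0_real.
have e0' : 0 < Re e by rewrite -ltcR -eE.
move/cvgrPdist_lt: fa => /(_ _ e0'); apply: filterS => x lt.
by rewrite eE -realcB normr_realc ltcR.
Qed.

Lemma cvg_sumc (T I : Type) (F : set_system T) (FF : Filter F) (r : seq I)
    (f : I -> T -> C) (a : I -> C) :
  (forall i, f i x @[x --> F] --> a i) ->
  \sum_(i <- r) f i x @[x --> F] --> \sum_(i <- r) a i.
Proof.
move=> fa; elim: r => [|i r IH].
  rewrite big_nil (_ : (fun x => _) = cst 0); first exact: cvg_cst.
  by apply/funext => x; rewrite big_nil.
rewrite big_cons (_ : (fun x => _) = f i \+ (fun x => \sum_(j <- r) f j x)); last first.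
  by apply/funext => x; rewrite big_cons.
exact: (cvgD (fa i) IH).
Qed.

Lemma cvg_prodc (T I : Type) (F : set_system T) (FF : Filter F) (r : seq I)
    (f : I -> T -> C) (a : I -> C) :
  (forall i, f i x @[x --> F] --> a i) ->
  \prod_(i <- r) f i x @[x --> F] --> \prod_(i <- r) a i.
Proof.
move=> fa; elim: r => [|i r IH].
  rewrite big_nil (_ : (fun x => _) = cst 1); first exact: cvg_cst.
  by apply/funext => x; rewrite big_nil.
rewrite big_cons (_ : (fun x => _) = f i \* (fun x => \prod_(j <- r) f j x)); last first.
  by apply/funext => x; rewrite big_cons.
exact: (cvgM (fa i) IH).
Qed.

Lemma cvg_expc (T : Type) (F : set_system T) (FF : Filter F) (f : T -> C) (a : C) k :
  f @ F --> a -> f x ^+ k @[x --> F] --> a ^+ k.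
Proof.
move=> fa; elim: k => [|k IH]; first exact: cvg_cst.
rewrite exprS (_ : (fun x => _) = f \* (fun x => f x ^+ k)); first exact: (cvgM fa IH).
by apply/funext => x; rewrite exprS.
Qed.

Lemma cvg_meval (T : Type) (F : set_system T) (FF : Filter F) (p : mpoly n C)
    (f : 'I_n -> T -> C) (a : 'I_n -> C) :
  (forall i, f i x @[x --> F] --> a i) ->
  meval (fun i => f i x) p @[x --> F] --> meval a p.
Proof.
move=> fa; rewrite mevalE (_ : (fun x => _) =
  fun x => \sum_(m <- msupp p) mcoeff m p * \prod_i f i x ^+ m i); last first.
  by apply/funext => x; rewrite mevalE.
apply: cvg_sumc => m; apply: cvgM; first exact: cvg_cst.
by apply: cvg_prodc => i; apply: cvg_expc.
Qed.

End RowConvergence.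

(** * A quantitative uniform boundedness argument *)

Section GlidingHump.
Variables (R : realType) (V : completeNormedModType R[i]).
Variable dot : {dot V for Num.conj}.
Hypothesis dotE : forall f, `|f| ^+ 2 = dot f f.
Local Notation adot f e := (Re `|dot f e|).

(** |f|^2 - |<f, e>|^2 is the squared norm of the component of f orthogonal to e. *)
Lemma dot_unit_le f e : rnorm e = 1 -> adot f e <= rnorm f.
Proof.
move=> e1; have de : dot e e = 1.
  by rewrite -dotE rnormE e1 rmorph1 expr1n.
have := dotE (f - dot f e *: e).
have -> : dot (f - dot f e *: e) (f - dot f e *: e) = dot f f - `|dot f e| ^+ 2.
  rewrite !(linearDl, linearDr, linearNl, linearNr, linearZl_LR, linearZr_LR) /= de.
  by rewrite -[X in _ - - X]/((dot f e)^* * (dot f e * 1)) (dotC dot e) normCK; ring.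
move=> E; rewrite -ler_sqr ?nnegrE ?Re_ge0 ?rnorm_ge0 //.
rewrite -lecR !realcX normr_ReE -rnormE dotE -subr_ge0 -E.
by rewrite exprn_ge0.
Qed.

Lemma adotZ (a : R) f e : adot (a%:C%C *: f) e = `|a| * adot f e.
Proof.
have -> : dot (a%:C%C *: f) e = a%:C%C * dot f e by exact: linearZl_LR.
by apply: complexI; rewrite normrM normr_realc realcM -normr_ReE -realcM.
Qed.

(* [x k] is built by adding [3^-k e k] or its opposite, whichever keeps the
   pairing with [e k] at least [3^-k]; the later steps change it by at most half. *)
Lemma gliding_hump (e : nat -> V) : (forall k, rnorm (e k) = 1) ->
  ~ (forall f, exists c : R, forall k, adot f (e k) <= c * (4^-1) ^+ k).
Proof.
move=> e1 decay.
(* The ratio 1/3 balances two demands: the steps after k add up to 3^-k / 2 at most, and 3^-k / 2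
   eventually exceeds c 4^-k. *)
pose d k : V := ((3^-1) ^+ k)%:C%C *: e k.
have dd k : adot (d k) (e k) = (3^-1) ^+ k.
  rewrite adotZ -dotE (rnormE (e k)) e1 -realcX expr1n normr_realc normr1 mulr1.
  by rewrite ger0_norm // exprn_ge0 // invr_ge0.
have nd k : rnorm (d k) = (3^-1) ^+ k.
  by rewrite rnormZ e1 mulr1 ger0_norm // exprn_ge0 // invr_ge0.
pose next k v := if adot (d k) (e k) <= adot (v + d k) (e k) then v + d k else v - d k.
pose x := fix x (k : nat) : V := if k is k'.+1 then next k' (x k') else 0.
have xS k : x k.+1 = next k (x k) by [].
rewrite /next in xS.
have adotD f g k : adot (f + g) (e k) <= adot f (e k) + adot g (e k).
  by rewrite linearDl -ReD; apply: ler_Re; apply: ler_normD.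
have adotN f k : adot (- f) (e k) = adot f (e k) by rewrite linearNl normrN.
(* The pairings of v + d and v - d with e_k differ by 2 * 3^-k in modulus, so one of them is large
   enough. *)
have xhump k : (3^-1) ^+ k <= adot (x k.+1) (e k).
  rewrite xS -dd; case: ifPn => //; rewrite -ltNge => /ltW h.
  have := adotD (x k + d k) (- (x k - d k)) k; rewrite adotN.
  have -> : x k + d k - (x k - d k) = 2%:C%C *: d k.
    rewrite opprB addrC addrA subrK -mulr2n -scaler_nat; congr (_ *: _).
    by rewrite rmorph_nat.
  rewrite adotZ [ `|2| ]ger0_norm //.
  by lra.
have xstep k : rnorm (x k.+1 - x k) = (3^-1) ^+ k.
  rewrite xS; case: ifP => _; first by rewrite addrAC subrr add0r nd.
  by rewrite addrAC subrr add0r rnormN nd.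
have xdist p q : (p <= q)%N -> rnorm (x q - x p) <= 3 / 2 * ((3^-1) ^+ p).
  move=> /subnK <-; set k := (q - p)%N.
  suff : rnorm (x (k + p)%N - x p) <= 3 / 2 * ((3^-1) ^+ p - (3^-1) ^+ (k + p)).
    have : 0 <= (3^-1 : R) ^+ (k + p) by rewrite exprn_ge0 // invr_ge0.
    by lra.
  elim: k => [|k IH]; first by rewrite !subrr mulr0 /rnorm normr0.
  apply: le_trans (rdistD (x (k + p)%N) _ _) _; rewrite addSn xstep exprS.
  by lra.
have r0 : (fun p => 3 / 2 * ((3^-1) ^+ p) : R) @ \oo --> 0.
  rewrite -[X in _ --> X](mulr0 (3 / 2)); apply: cvgMr.
  by apply: cvg_expr; rewrite ger0_norm ?invf_lt1 ?invr_ge0 ?ltr1n.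
have [l lx] := complete_limit r0 xdist.
have [c hc] := decay l.
have low k : 2^-1 * (3^-1) ^+ k <= adot l (e k).
  have := adotD l (x k.+1 - l) k; rewrite addrCA subrr addr0 => h.
  have := dot_unit_le (x k.+1 - l) (e1 k); rewrite rdistC => h2.
  have := lx k.+1; rewrite exprS => h3; have := xhump k => h4.
  by lra.
have : (fun k => c * (3 / 4) ^+ k) @ \oo --> 0.
  rewrite -[X in _ --> X](mulr0 c); apply: cvgMr.
  by apply: cvg_expr; rewrite ger0_norm; lra.
have half0 : 0 < 2^-1 :> R by rewrite invr_gt0.
move=> /cvgrPdist_lt /(_ _ half0)[N _ /(_ N (leqnn N))] /=.
rewrite sub0r normrN => lt.
have le := le_trans (low N) (hc N).
have pos : 0 < (3^-1 : R) ^+ N by rewrite exprn_gt0 // invr_gt0.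
have E : (4^-1 : R) ^+ N = (3^-1) ^+ N * (3 / 4) ^+ N.
  by rewrite -exprMn; congr (_ ^+ _); field.
move: le; rewrite E mulrCA mulrC ler_pM2l // => le.
by have := le_lt_trans le (le_lt_trans (ler_norm _) lt); rewrite ltxx.
Qed.

End GlidingHump.

(** * Points of the closure lie in the spectrum *)

Section ClosureSpectrum.
Variables (R : realType) (n : nat) (D : set 'rV[R[i]]_n).
Variables (K : 'rV[R[i]]_n -> 'rV[R[i]]_n -> R[i]) (H : rkhs D K).
Local Notation C := R[i].
Local Notation ev := (rkhs_eval H).
Hypothesis K0 : forall z, D z -> K z z != 0.
Hypothesis mz : forall j, multiplier H (fun z => z 0 j).

(** Exactness in top degree: the ranges of the n operators together span the space. *)
Lemma koszul_exact_surj (l : 'rV[C]_n) :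
    koszul_exact (fun j v => coord_mulop H j v - l 0 j *: v) ->
  forall f : H, exists y : 'I_n -> H,
    forall z, D z -> ev f z = \sum_j (z 0 j - l 0 j) * ev (y j) z.
Proof.
move=> exact f.
pose x : {ffun {set 'I_n} -> H} :=
  [ffun S : {set 'I_n} => if S == finset.setT then f else 0].
(* Since [mulop] is defined by choice, its value at 0 has to be derived from [rkhs_ext]. *)
have T0 j : coord_mulop H j 0 - l 0 j *: 0 = 0.
  rewrite scaler0 subr0; apply: rkhs_ext => z Dz.
  by rewrite mulopE // linear0 mulr0.
have degx : koszul_deg n x.
  move=> S Sn; rewrite ffunE; case: (S =P finset.setT) Sn => // ->.
  by rewrite cardsT card_ord eqxx.
have dx : koszul_d (fun j v => coord_mulop H j v - l 0 j *: v) x = 0.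
  apply/ffunP => S; rewrite !ffunE big1 // => j jS; rewrite ffunE.
  case: ((S :\ j)%SET =P finset.setT) => [ST|_]; last by rewrite T0 scaler0.
  by have := finset.in_setT j; rewrite -ST !inE eqxx.
have [y [_ dy]] := exact n x degx dx.
exists (fun j : 'I_n =>
  (-1) ^+ koszul_sign [set: 'I_n]%SET j *: y ([set: 'I_n] :\ j)%SET).
move=> z Dz; have := congr1 (fun u : {ffun {set 'I_n} -> H} => u [set: 'I_n]%SET) dy.
rewrite !ffunE eqxx => <-; rewrite rkhs_eval_sum.
apply: eq_big => [j|j _]; first by rewrite !inE.
rewrite !rkhs_evalZ addrC -scaleNr rkhs_evalP mulopE //; ring.
Qed.

(** Under exactness f(w) = sum of (w_j - l_j) y_j(w). Pairing f with the normalized kernel function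
    at w gives at most sup_j |w_j - l_j| times the sum of the norms of the y_j, and w_k at distance
    below 4^-k contradicts [gliding_hump]. *)
Lemma closure_spectrum : closure D `<=` taylor_spectrum (coord_mulop H).
Proof.
move=> l cl exact.
pose r k : R := (4^-1) ^+ k.
have r0 k : 0 < r k by rewrite exprn_gt0 // invr_gt0.
have /choice[w wP] : forall k, exists w, D w /\ forall j, `|w 0 j - l 0 j| < (r k)%:C%C.
  by move=> k; have [w Dw wl] := closure_dist cl (r0 k); exists w.
have /choice[kw kwP] : forall k, exists kw : H,
    0 < rnorm kw /\ forall f, rkhs_dot H f kw = ev f (w k).
  move=> k; have [Dw _] := wP k; have [kw kw1 kw2] := rkhs_reproducing H Dw.
  exists kw; split=> //; rewrite lt_def rnorm_ge0 andbT.
  apply: contraNneq (K0 Dw) => kw0.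
  by rewrite -kw1 // -kw2 -rkhs_normE rnormE kw0 expr0n.
pose rho k := rnorm (kw k).
pose e k := ((rho k)^-1)%:C%C *: kw k.
have rho0 k : 0 < rho k by case: (kwP k).
have e1 k : rnorm (e k) = 1.
  by rewrite rnormZ ger0_norm ?invr_ge0 ?ltW // mulVf // gt_eqF.
have ee f k : rkhs_dot H f (e k) = ((rho k)^-1)%:C%C * ev f (w k).
  have [_ <-] := kwP k; rewrite -[X in X * _]realc_conj.
  exact: linearZr_LR.
apply: (gliding_hump (rkhs_normE (r := H)) e1) => f.
have [y yP] := koszul_exact_surj exact f.
exists (\sum_j rnorm (y j)) => k.
have [Dw wl] := wP k.
rewrite ee yP // mulr_sumr -ler_complexR // mulr_suml realc_sum.
apply: le_trans (ler_norm_sum _ _ _) (ler_sum _ _) => j _.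
rewrite mulrCA -ee normrM realcM mulrC -normr_ReE.
apply: ler_pM => //; first by rewrite lecR Re_ge0.
  by rewrite lecR; apply: dot_unit_le => //; exact: rkhs_normE.
by rewrite ltW.
Qed.

End ClosureSpectrum.

(** * The closed triangle *)

Section TailProduct.
Variables (R : realType) (n : nat).
Local Notation C := R[i].
Implicit Types (v l z : 'rV[C]_n) (i j : 'I_n).

(** The inverse of [phi], namely z_j = u_j ... u_n: unlike [phi] it is polynomial, hence continuous
    everywhere. *)
Definition tail_prod v : 'rV[C]_n := \row_j \prod_(i < n | (j <= i)%N) v 0 i.

Lemma tail_prod_last v j : ~~ (j.+1 < n)%N -> tail_prod v 0 j = v 0 j.
Proof.
rewrite -leqNgt => jn; rewrite mxE (big_pred1 j) // => i /=.
apply/idP/eqP => [ji|->//]; apply/val_inj/eqP; rewrite eqn_leq ji andbT.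
by rewrite -ltnS (leq_trans (ltn_ord i)).
Qed.

Lemma tail_prod_lt v j : (j.+1 < n)%N ->
  tail_prod v 0 j = v 0 j * tail_prod v 0 (ordS j).
Proof.
move=> jn; rewrite !mxE (bigD1 j) //=; congr (_ * _); apply: eq_bigl => i.
by rewrite modn_small // [RHS]ltn_neqAle eq_sym andbC.
Qed.

Lemma tail_prod_neq0 v j : (forall i, v 0 i != 0) -> tail_prod v 0 j != 0.
Proof. by move=> v0; rewrite mxE; apply/prodf_neq0. Qed.

Lemma phi_tail_prod v : (forall i, v 0 i != 0) -> phi (tail_prod v) = v.
Proof.
move=> v0; apply/rowP => j; have [jn|jn] := boolP (j.+1 < n)%N.
  by rewrite phi_lt // tail_prod_lt // mulfK // tail_prod_neq0.
by rewrite phi_last // tail_prod_last.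
Qed.

Lemma tail_prod_phi l :
    (forall j, (j.+1 < n)%N -> l 0 (ordS j) = 0 -> l 0 j = 0) ->
  tail_prod (phi l) = l.
Proof.
move=> l0; apply/rowP => j.
have [k] := ubnP (n - j); elim: k j => // k IH j jk.
have [jn|jn] := boolP (j.+1 < n)%N; last by rewrite tail_prod_last // phi_last.
rewrite tail_prod_lt // phi_lt // IH; last first.
  by rewrite /= modn_small // subnS prednK // subn_gt0.
(* At the junk value of [phi], the hypothesis on l forces l_j = 0, so both sides vanish. *)
have [lS|lS] := eqVneq (l 0 (ordS j)) 0; last by rewrite divfK.
by rewrite lS mulr0 l0.
Qed.

Lemma cvg_tail_prod (T : Type) (F : set_system T) (FF : Filter F)
    (v : T -> 'rV[C]_n) (u : 'rV[C]_n) :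
  (forall i, v x 0 i @[x --> F] --> (u 0 i : C)) ->
  tail_prod (v x) @[x --> F] --> tail_prod u.
Proof.
move=> vu; apply: cvg_row => j; rewrite mxE big_mkcond /=.
rewrite (_ : (fun x => _) = fun x => \prod_(i < n) (if (j <= i)%N then v x 0 i else 1)).
  by apply: cvg_prodc => i; case: ifP => _ //; apply: cvg_cst.
by apply/funext => x; rewrite mxE big_mkcond.
Qed.

(** Consecutive weights differ by one and the last is 1, so that [phi] turns the dilation into
    scalar multiplication by t. *)
Definition dilate (t : R) l : 'rV[C]_n := \row_j (t%:C%C ^+ (n - j) * l 0 j).

Lemma phi_dilate t l : phi (dilate t l) = t%:C%C *: phi l.
Proof.
apply/rowP => j; rewrite [RHS]mxE; have [jn|jn] := boolP (j.+1 < n)%N; last first.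
  have nj : n = j.+1 by apply/eqP; rewrite eqn_leq ltn_ord andbT leqNgt.
  rewrite !phi_last // mxE [X in _ ^+ X](_ : _ = 1%N) ?expr1 //.
  by rewrite [X in (X - _)%N]nj subSnn.
rewrite !phi_lt // !mxE /= modn_small //.
have [->|t0] := eqVneq t 0.
  by rewrite rmorph0 expr0n subn_eq0 leqNgt ltn_ord /= !mul0r.
have tC : t%:C%C != 0 :> C by rewrite fmorph_eq0.
have -> : (n - j = (n - j.+1).+1)%N by rewrite subnS prednK // subn_gt0.
have [lS|lS] := eqVneq (l 0 (ordS j)) 0; first by rewrite lS mulr0 !invr0 !mulr0.
by rewrite exprS; field; rewrite lS expf_neq0.
Qed.

Lemma dilate1 l : dilate 1 l = l.
Proof. by apply/rowP => j; rewrite mxE rmorph1 expr1n mul1r. Qed.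

Lemma dilate0 l : dilate 0 l = 0.
Proof. by apply/rowP => j; rewrite !mxE rmorph0 expr0n subn_eq0 leqNgt ltn_ord mul0r. Qed.

Lemma cvg_dilate (T : Type) (F : set_system T) (FF : Filter F) (f : T -> R) (t : R) l :
  f @ F --> t -> dilate (f x) l @[x --> F] --> dilate t l.
Proof.
move=> ft; apply: cvg_row => j; rewrite mxE.
rewrite (_ : (fun x => _) = fun x => (f x)%:C%C ^+ (n - j) * l 0 j); last first.
  by apply/funext => x; rewrite mxE.
apply: cvgM; last exact: cvg_cst.
by apply: cvg_expc; apply: cvg_realc.
Qed.

End TailProduct.

(** * Approximation from the triangle, and connectedness *)

Section ClosedTriangle.
Variables (R : realType) (n : nat) (P : 'I_n -> mpoly n R[i]).
Hypothesis hP : positive_regular P.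
Local Notation C := R[i].
Local Notation CT := (closed_triangle P).

Lemma poly_ker_dilate j (t : R) (l : 'rV[C]_n) : 0 <= t <= 1 -> CT l ->
  poly_ker (P j) (phi (dilate t l)) (phi (dilate t l)) <= t%:C%C.
Proof.
move=> t01 [_ /(_ j) l1]; rewrite phi_dilate.
apply: le_trans (poly_ker_scale _ _ _ t01) _.
- exact: positive_regular_nonneg.
- exact: positive_regular_coef0.
by rewrite ler_piMr // ler0c; case/andP: t01.
Qed.

Lemma closed_triangle_dilate (t : R) (l : 'rV[C]_n) : 0 <= t <= 1 -> CT l -> CT (dilate t l).
Proof.
move=> t01 Xl; split=> [j jn|j]; last first.
  apply: le_trans (poly_ker_dilate j t01 Xl) _.
  by rewrite -[1]/(1%:C%C) lecR; case/andP: t01.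
have [->|t0] := eqVneq t 0; first by rewrite dilate0 !mxE.
have [l0 _] := Xl; rewrite !mxE => /eqP.
rewrite mulf_eq0 expf_eq0 fmorph_eq0 (negbTE t0) andbF /=.
by move=> /eqP /(l0 _ jn) ->; rewrite mulr0.
Qed.

(* The zero coordinates of [phi l] are perturbed to [eta k]. *)
Lemma closed_triangle_interior (l : 'rV[C]_n) : CT l ->
  (forall j, poly_ker (P j) (phi l) (phi l) < 1) -> closure (triangle P) l.
Proof.
move=> [l0 _] l1.
pose eta k : C := (k.+1%:R^-1 : R)%:C%C.
have eta0 : eta @ \oo --> (0 : C).
  by apply: (@cvg_realc R _ \oo _ _ 0); apply: cvg_harmonic.
have eta_neq0 k : eta k != 0 by rewrite fmorph_eq0 invr_eq0 pnatr_eq0.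
pose v k : 'rV[C]_n := \row_i (if phi l 0 i == 0 then eta k else phi l 0 i).
have v_neq0 k i : v k 0 i != 0 by rewrite mxE; case: ifP => // /negbT.
have cvg_v i : v k 0 i @[k --> \oo] --> (phi l 0 i : C).
  rewrite (_ : (fun k => _) = fun k => if phi l 0 i == 0 then eta k else phi l 0 i).
    by case: eqP => [u0|_]; [rewrite u0; exact: eta0|exact: cvg_cst].
  by apply/funext => k; rewrite mxE.
have cvg_p j : poly_ker (P j) (v k) (v k) @[k --> \oo] --> poly_ker (P j) (phi l) (phi l).
  apply: cvg_meval => i; rewrite [diamond _ _ 0 i]mxE [conjv _ 0 i]mxE.
  rewrite (_ : (fun k => _) = fun k =>
      if phi l 0 i == 0 then eta k * eta k else phi l 0 i * (phi l 0 i)^*).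
    case: eqP => [u0|_]; last exact: cvg_cst.
    by rewrite u0 mul0r -[X in _ --> X](mulr0 (0 : C)); exact: (cvgM eta0 eta0).
  apply/funext => k; rewrite [LHS]mxE [conjv _ 0 i]mxE [v k 0 i]mxE.
  by case: ifP => // _; rewrite realc_conj.
(* l is the limit of the [tail_prod (v k)]; these have nonzero coordinates and [phi] maps them back
   to [v k], so they eventually lie in the triangle. *)
rewrite -(tail_prod_phi l0).
apply: (closed_cvg _ (@closed_closure _ _) _ _ (cvg_tail_prod eventually_filter cvg_v)).
have : \forall k \near \oo, forall j, poly_ker (P j) (v k) (v k) < 1.
  apply: filter_forall => j.
  have e0 : 0 < 1 - poly_ker (P j) (phi l) (phi l) by rewrite subr_gt0.
  move/cvgrPdist_lt: (cvg_p j) => /(_ _ e0); apply: filterS => k.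
  have p0 u := poly_ker_ge0 u (positive_regular_nonneg j hP).
  rewrite distrC => /(le_lt_trans (real_ler_norm _)).
  by rewrite realB ?ger0_real // ltrD2r; apply.
apply: filterS => k v1; apply: subset_closure; split=> [i _|j].
  exact: tail_prod_neq0.
by rewrite phi_tail_prod //; apply: v1.
Qed.

(** Dilating by t < 1 makes every P_j at most t < 1, the case of [closed_triangle_interior]; then t
    tends to 1. *)
Lemma closed_triangle_closure : CT `<=` closure (triangle P).
Proof.
move=> l Xl.
pose t k : R := 1 - k.+1%:R^-1.
have t01 k : 0 <= t k <= 1.
  by rewrite subr_ge0 invf_le1 // ler1n /= gerBl invr_ge0.
have t1 : t @ \oo --> (1 : R).
  rewrite -[X in _ --> X](subr0 (1 : R)); apply: cvgB; first exact: cvg_cst.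
  exact: cvg_harmonic.
rewrite -(dilate1 l).
apply: (closed_cvg _ (@closed_closure _ _) _ _
  (cvg_dilate (l := l) eventually_filter t1)).
apply: nearW => k; apply: closed_triangle_interior => [|j].
  exact: closed_triangle_dilate.
apply: le_lt_trans (poly_ker_dilate j (t01 k) Xl) _.
by rewrite -[1]/(1%:C%C) ltcR gtrBl invr_gt0.
Qed.

Lemma connected_closed_triangle : connected CT.
Proof.
(* A union of arcs t -> [dilate t l], each inside the set and passing through 0 at t = 0. *)
have -> : CT = \bigcup_(l in CT) ((fun t : R => dilate t l) @` `[0%R, 1%R]%classic).
  apply/seteqP; split=> [l Xl|l [l' Xl' [t t01 <-]]].
    by exists l => //; exists 1; rewrite ?dilate1 //= in_itv /= ler01 lexx.
  by apply: closed_triangle_dilate => //; move: t01; rewrite /= in_itv.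
apply: bigcup_connected => [|l Xl].
  by exists 0 => l Xl; exists 0; rewrite ?dilate0 //= in_itv /= ler01 lexx.
apply: connected_continuous_connected; first exact: segment_connected.
apply: continuous_subspaceT => t.
apply: cvg_dilate; exact: cvg_id.
Qed.

End ClosedTriangle.

Theorem proposition4p6 (R : realType) (n : nat) (hn : (2 <= n)%N)
    (P : 'I_n -> mpoly n R[i]) (hP : positive_regular P)
    (m : 'I_n -> nat) (hm : forall j, (1 <= m j)%N)
    (H : rkhs (triangle P) (triangle_kernel P m)) :
  connected (taylor_spectrum (coord_mulop H)) /\
  closure (triangle P) `<=` taylor_spectrum (coord_mulop H).
Proof.
have sub := closure_spectrum (triangle_kernel_neq0 m hP)
  (multiplier_coord hP hm (H := H)).
(* The inclusions spectrum, [closed_triangle P], closure of the triangle, spectrum form a cycle, so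
   all three sets coincide. *)
split=> //; rewrite (_ : taylor_spectrum _ = closed_triangle P).
  exact: connected_closed_triangle.
apply/seteqP; split; first exact: taylor_spectrum_sub.
exact: subset_trans (closed_triangle_closure hP) sub.
Qed.
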